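(* Let $b_1,\dots,b_{r+n}$ be a basis of the all-coefficients lattice $L$ that is LLL-reduced (with parameter $3/4$), let $b_1^*,\dots,b_{r+n}^*$ be its Gram–Schmidt orthogonalization, and let $t$ be the smallest index such that $\|b_j^*\|>B'$ for all $j>t$. Let $L'=\mathbb{Z}b_1+\cdots+\mathbb{Z}b_t$. If $$v^{\ell/n}>\|f\|\,(2^{n-1}+n)\,B'\,(1+B'),$$ then the projection of $L'$ onto the first $r$ coordinates equals $W$.
   Context: Let $v$ be a prime number, $\mathbb{Z}_v$ the $v$-adic integers. Let $f\in\mathbb{Z}[X]$ be separable of degree $n\ge2$ with leading coefficient $\ell_f$ not divisible by $v$, and assume $f$ mod $v$ is separable in $\mathbb{F}_v[X]$. Write $f=\ell_f f_1\cdots f_r$ with $f_i\in\mathbb{Z}_v[X]$ monic irreducible over $\mathbb{Q}_v$, and $f=\ell_f g_1\cdots g_s$ with $g_j\in\mathbb{Q}[X]$ monic irreducible. Write $g_j=f_1^{w_{j,1}}\cdots f_r^{w_{j,r}}$ with $w_{j,i}\in\{0,1\}$, $w_j=(w_{j,1},\dots,w_{j,r})^{T}\in\mathbb{Z}^r$, and $W=\mathbb{Z}w_1+\cdots+\mathbb{Z}w_s$. For a polynomial $g$, $\Phi(g)=fg'/g$. Fix an integer $\ell>0$ and integers $a_{i,j}$ ($0\le i\le n-1$, $1\le j\le r$) such that $a_{i,j}$ is congruent modulo $v^\ell\mathbb{Z}_v$ to the coefficient of $X^i$ in $\Phi(f_j)\in\mathbb{Z}_v[X]$. The all-coefficients lattice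 $L\subseteq\mathbb{Z}^{r+n}$ is the lattice spanned by the columns of the $(r+n)\times r$ matrix $\begin{pmatrix}I_r\\ A_1\end{pmatrix}$, $A_1=(a_{i,j})$, together with the vectors $v^\ell e_{r+1},\dots,v^\ell e_{r+n}$ ($e_k$ the standard unit vectors); it has rank $r+n$. $\|\cdot\|$ is the Euclidean ($L^2$) norm on vectors and on coefficient vectors of polynomials. $B=2^{n-1}n\|f\|$ and $B'=\sqrt{r^2+B^2}$. A basis $b_1,\dots,b_m$ with Gram–Schmidt vectors $b_j^*$ and coefficients $\mu_{jk}=\langle b_j,b_k^*\rangle/\langle b_k^*,b_k^*\rangle$ is LLL-reduced with parameter $3/4$ if $|\mu_{jk}|\le 1/2$ for $k<j$ and $\|b_j^*\|^2\ge(3/4-\mu_{j,j-1}^2)\|b_{j-1}^*\|^2$ for $j>1$. *)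

(* Defs.v *)
From HB Require Import structures.
From mathcomp Require Import all_boot all_order all_algebra all_field.
Set Implicit Arguments. Unset Strict Implicit. Unset Printing Implicit Defensive.
Import Order.TTheory GRing.Theory Num.Theory.
Local Open Scope ring_scope.

Definition pcong (m : int) (p q : {poly int}) : Prop :=
  forall i : nat, (m %| p`_i - q`_i)%Z.

(* P : nat -> {poly int} represents an element of Z_v[X]: P k is its
   approximation modulo v^(k+1), and consecutive approximations agree. *)
Definition vcoherent (v : nat) (P : nat -> {poly int}) : Prop :=
  forall k : nat, pcong ((v%:Z) ^+ k.+1) (P k.+1) (P k).

Definition vmonic (v : nat) (P : nat -> {poly int}) : Prop :=
  vcoherent v P /\ forall k, P k \is monic.

(* A monic P in Z_v[X] is irreducible over Q_v: it is nonconstant and (Gauss'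
   lemma over the DVR Z_v) it has no factorization P = G * H in Z_v[X] with
   G, H monic of positive degree. *)
Definition vQirreducible (v : nat) (P : nat -> {poly int}) : Prop :=
  (1 < size (P 0%N))%N /\
  ~ (exists G H : nat -> {poly int},
        [/\ vmonic v G, vmonic v H, (1 < size (G 0%N))%N, (1 < size (H 0%N))%N &
            forall k, pcong ((v%:Z) ^+ k.+1) (P k) (G k * H k)]).

(* Approximation of Phi(P) = f P' / P (modulo v^(k+1)) for a monic divisor P of f
   in Z_v[X]: exact division by the monic approximation P k. *)
Definition Phi_approx (f : {poly int}) (P : nat -> {poly int}) (k : nat) : {poly int} :=
  (f * (P k)^`()) %/ (P k).

Definition dotr (R : pzRingType) (k : nat) (x y : 'rV[R]_k) : R :=
  \sum_(i < k) x 0 i * y 0 i.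

Definition rowq (m k : nat) (B : 'M[int]_(m, k)) (j : nat) : 'rV[rat]_k :=
  if insub j is Some i then map_mx (fun z : int => z%:~R) (row i B) else 0.

Fixpoint gs_list (k : nat) (bv : nat -> 'rV[rat]_k) (j : nat) : seq 'rV[rat]_k :=
  match j with
  | 0 => [::]
  | j.+1 => let s := gs_list bv j in
            rcons s (bv j - \sum_(y <- s) (dotr (bv j) y / dotr y y) *: y)
  end.

Definition gso (k : nat) (bv : nat -> 'rV[rat]_k) (j : nat) : 'rV[rat]_k :=
  nth 0 (gs_list bv j.+1) j.

Definition gsmu (k : nat) (bv : nat -> 'rV[rat]_k) (j i : nat) : rat :=
  dotr (bv j) (gso bv i) / dotr (gso bv i) (gso bv i).

Definition gsnorm2 (k : nat) (bv : nat -> 'rV[rat]_k) (j : nat) : rat :=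
  dotr (gso bv j) (gso bv j).

Definition lll_reduced (m : nat) (B : 'M[int]_m) : Prop :=
  (forall j i : 'I_m, (i < j)%N -> `|gsmu (rowq B) j i| <= 1 / 2) /\
  (forall j : nat, (0 < j < m)%N ->
     (3 / 4 - (gsmu (rowq B) j j.-1) ^+ 2) * gsnorm2 (rowq B) j.-1
       <= gsnorm2 (rowq B) j).

(* Generator matrix of the all-coefficients lattice L (rows = generators):
   the rows are the columns of (I_r ; A_1) followed by v^l e_{r+1..r+n}. *)
Definition allcoef_gen (v l r n : nat) (a : 'I_n -> 'I_r -> int) : 'M[int]_(r + n) :=
  block_mx 1%:M (\matrix_(j < r, i < n) a i j) 0 ((((v%:Z) ^+ l))%:M).

Definition polynorm (f : {poly int}) : algC :=
  sqrtC (\sum_(i < size f) ((f`_i)%:~R : algC) ^+ 2).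

(* Main.v *)
(** Let [N] be the squared norm of [f], [m = v^l], and write [Phi p = f p'/p].

    - Each coefficient of [f / (X - alpha)], for a root [alpha] of [f], is at most
      [sqrt (n N)] in absolute value.  Hence every [(w_j, Phi g_j)], which lies in
      [L], is no longer than [B'], and so it lies in [L'].
    - By LLL-reducedness the vectors [b_1 .. b_t] are no longer than
      [2^(n-1) sqrt 2 B'].  Let [(x, H)] be one of them, so that [H] is congruent to
      the combination of the [Phi f_i] with coefficients [x_i], and pick an index
      [i_j] in the support of each [w_j].  If [g_j] divides [H - x_(i_j) Phi g_j]
      for all [j], then [x] is constant on each support modulo [m], hence constant
      since it is small, and [x] is in [W].  Otherwise, the polynomial
      [H3 = H - sum_j c_j Phi g_j], with [c_j = x_(i_j)] for the [j] violating this
      divisibility and some [c_j <> x_(i_j)] in [{0, 1}] for the other [j], is coprime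
      to [f]; but [f] and [H3] have a common factor [f_(i_j)] modulo [m], so the
      nonzero integer [Res(f, H3)] is a multiple of [m], against Hadamard's bound. *)
Require Import Defs.
From HB Require Import structures.
From mathcomp Require Import all_boot all_order all_algebra all_field.
From mathcomp Require Import ring lra zify.
Set Implicit Arguments. Unset Strict Implicit. Unset Printing Implicit Defensive.
Import Order.TTheory GRing.Theory Num.Theory.
Local Open Scope ring_scope.

(** * Gram-Schmidt vectors, Hadamard's inequality, LLL-reduced bases *)

Section Dot.
Variables (R : comPzRingType) (k : nat).
Implicit Types x y z : 'rV[R]_k.

Lemma dotrC x y : dotr x y = dotr y x.
Proof. by apply: eq_bigr => i _; rewrite mulrC. Qed.

Lemma dotrDl x y z : dotr (x + y) z = dotr x z + dotr y z.
Proof. by rewrite -big_split; apply: eq_bigr => i _; rewrite mxE mulrDl. Qed.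

Lemma dotrZl c x y : dotr (c *: x) y = c * dotr x y.
Proof. by rewrite mulr_sumr; apply: eq_bigr => i _; rewrite mxE mulrA. Qed.

Lemma dotrBl x y z : dotr (x - y) z = dotr x z - dotr y z.
Proof. by rewrite dotrDl -scaleN1r dotrZl mulN1r. Qed.

Lemma dotr0l x : dotr 0 x = 0.
Proof. by rewrite -(scale0r 0) dotrZl mul0r. Qed.

Lemma dotr_suml (I : Type) (s : seq I) (P : pred I) (G : I -> 'rV[R]_k) z :
  dotr (\sum_(i <- s | P i) G i) z = \sum_(i <- s | P i) dotr (G i) z.
Proof. by elim/big_rec2: _ => [|i u x _ <-]; rewrite ?dotr0l ?dotrDl. Qed.

End Dot.

Section DotOrder.
Variables (R : realDomainType) (k : nat).
Implicit Types x y : 'rV[R]_k.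

Lemma dotr_ge0 x : 0 <= dotr x x.
Proof. by apply: sumr_ge0 => i _; rewrite -expr2 sqr_ge0. Qed.

Lemma dotr_eq0 x : dotr x x = 0 -> x = 0.
Proof.
move/eqP; rewrite psumr_eq0 => [/allP x0|i _]; last by rewrite -expr2 sqr_ge0.
apply/rowP => i; rewrite mxE; apply/eqP.
by have := x0 i (mem_index_enum _); rewrite mulf_eq0 orbb.
Qed.

Lemma dotr_cauchy x y : dotr x y ^+ 2 <= dotr x x * dotr y y.
Proof.
have [y0|y0] := eqVneq (dotr y y) 0.
  by rewrite (dotr_eq0 y0) dotrC !dotr0l expr0n mulr0.
have y_gt0 : 0 < dotr y y by rewrite lt_neqAle eq_sym y0 dotr_ge0.
rewrite -subr_ge0 -(pmulr_rge0 _ y_gt0).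
(* This is the component of [x] orthogonal to [y], scaled by [dotr y y] so that no division
   occurs. *)
have := dotr_ge0 (dotr y y *: x - dotr x y *: y).
rewrite dotrBl !dotrZl !(dotrC _ (_ - _)) !dotrBl !dotrZl (dotrC y x).
by congr (_ <= _); ring.
Qed.

End DotOrder.

Lemma sqr_sum_le (R : realDomainType) (k : nat) (x : 'I_k -> R) :
  (\sum_i x i) ^+ 2 <= k%:R * \sum_i x i ^+ 2.
Proof.
have := dotr_cauchy (const_mx 1) (\row_i x i).
rewrite /dotr; congr (_ ^+ 2 <= _ * _).
- by apply: eq_bigr => i _; rewrite !mxE mul1r.
- rewrite (eq_bigr (fun=> 1)); first by rewrite sumr_const card_ord.
  by move=> i _; rewrite !mxE mulr1.
- by apply: eq_bigr => i _; rewrite !mxE expr2.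
Qed.

Section GramSchmidt.
Variables (k : nat) (bv : nat -> 'rV[rat]_k).

Lemma gs_listE j : gs_list bv j = mkseq (gso bv) j.
Proof.
elim: j => [//|j IHj]; rewrite mkseqS -IHj /= /gso /=.
by rewrite nth_rcons IHj size_mkseq ltnn eqxx.
Qed.

Lemma gso_rec j :
  bv j = gso bv j + \sum_(i < j) gsmu bv j i *: gso bv i.
Proof.
rewrite {1}/gso /= nth_rcons gs_listE size_mkseq ltnn eqxx big_map.
rewrite -(big_mkord xpredT (fun i => gsmu bv j i *: gso bv i)).
by rewrite /index_iota subn0 subrK.
Qed.

Lemma gso_orth i j : (i < j)%N -> dotr (gso bv j) (gso bv i) = 0.
Proof.
elim/ltn_ind: j i => j IHj i ltij.
have -> : gso bv j = bv j - \sum_(i < j) gsmu bv j i *: gso bv i.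
  by rewrite {1}gso_rec addrK.
rewrite dotrBl dotr_suml (bigD1 (Ordinal ltij)) //= big1 => [|h]; last first.
  rewrite -val_eqE /= dotrZl => neq_hi.
  have [lt_hi|] := ltnP h i; first by rewrite dotrC IHj ?mulr0.
  rewrite leq_eqVlt eq_sym (negPf neq_hi) => /= lt_ih.
  by rewrite IHj ?mulr0.
rewrite dotrZl addr0 /gsmu.
(* If the Gram-Schmidt vector is zero, the quotient has denominator 0, but every inner product with
   that vector vanishes too. *)
have [g0|g0] := eqVneq (dotr (gso bv i) (gso bv i)) 0; last by rewrite divfK ?subrr.
by rewrite (dotr_eq0 g0) dotrC !dotr0l !mul0r subrr.
Qed.

Lemma dotr_gso j : dotr (bv j) (gso bv j) = gsnorm2 bv j.
Proof.
rewrite {1}gso_rec dotrDl dotr_suml big1 ?addr0 // => i _.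
by rewrite dotrZl dotrC gso_orth ?mulr0.
Qed.

Lemma dotr_gso_lt i j : (i < j)%N -> dotr (bv i) (gso bv j) = 0.
Proof.
move=> ltij; rewrite gso_rec dotrDl dotrC gso_orth // add0r dotr_suml big1 //.
by move=> h _; rewrite dotrZl dotrC gso_orth ?mulr0 // (ltn_trans _ ltij).
Qed.

Lemma gso_pythagoras j :
  dotr (bv j) (bv j) =
  gsnorm2 bv j + \sum_(i < j) gsmu bv j i ^+ 2 * gsnorm2 bv i.
Proof.
rewrite {2}gso_rec dotrC dotrDl dotrC dotr_gso dotr_suml; congr (_ + _).
apply: eq_bigr => i _; rewrite dotrZl dotrC expr2 -mulrA; congr (_ * _).
rewrite /gsmu /gsnorm2.
have [g0|g0] := eqVneq (dotr (gso bv i) (gso bv i)) 0; last by rewrite divfK.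
by rewrite (dotr_eq0 g0) dotrC !dotr0l !mul0r.
Qed.

Lemma gsnorm2_le j : gsnorm2 bv j <= dotr (bv j) (bv j).
Proof.
rewrite gso_pythagoras lerDl sumr_ge0 // => i _.
by rewrite mulr_ge0 ?sqr_ge0 ?dotr_ge0.
Qed.

End GramSchmidt.

Lemma rowqE (m k : nat) (B : 'M[int]_(m, k)) (i : 'I_m) :
  rowq B i = map_mx intr (row i B).
Proof. by rewrite /rowq valK. Qed.

Lemma dotr_rowq (m k : nat) (B : 'M[int]_(m, k)) (i : 'I_m) :
  dotr (rowq B i) (rowq B i) = (dotr (row i B) (row i B))%:~R.
Proof.
by rewrite rowqE rmorph_sum; apply: eq_bigr => j _; rewrite !mxE rmorphM.
Qed.

(** Write [A = U G] with [U] unitriangular, made of the coefficients [gsmu], and [G] made of the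
    Gram-Schmidt rows. Then [G G^T] is diagonal, and orthogonalization does not lengthen a row. *)
Lemma hadamard (k : nat) (A : 'M[int]_k) :
  (\det A) ^+ 2 <= \prod_i dotr (row i A) (row i A).
Proof.
pose G : 'M[rat]_k := \matrix_i gso (rowq A) i.
pose U : 'M[rat]_k :=
  \matrix_(i, j) (if (j < i)%N then gsmu (rowq A) i j else (i == j)%:R).
have AE : map_mx intr A = U *m G.
  apply/row_matrixP => i; rewrite -map_row -rowqE (gso_rec (rowq A) i) row_mul mulmx_sum_row.
  rewrite (bigD1 i) //= !mxE ltnn eqxx scale1r rowK; congr (_ + _).
  rewrite (big_ord_widen k (fun j => gsmu (rowq A) i j *: gso (rowq A) j)) 1?ltnW //.
  rewrite [RHS](bigID (fun j : 'I_k => (j < i)%N)) /= [X in _ + X]big1 ?addr0 => [|j].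
    apply: eq_big => [j|j lt_ji]; last by rewrite !mxE lt_ji rowK.
    by rewrite -val_eqE /= andbC; case: ltngtP.
  by case/andP=> neq_ji /negPf nlt; rewrite !mxE nlt eq_sym (negPf neq_ji) scale0r.
have detU : \det U = 1.
  rewrite det_trig; first by rewrite big1 // => i _; rewrite mxE ltnn eqxx.
  apply/is_trig_mxP => i j ltij; rewrite mxE ltnNge (ltnW ltij) /=.
  by rewrite -val_eqE ltn_eqF.
have detG : (\det G) ^+ 2 = \prod_(i < k) gsnorm2 (rowq A) i.
  rewrite expr2 -{2}det_tr -det_mulmx.
  have -> : G *m G^T = diag_mx (\row_(i < k) gsnorm2 (rowq A) i).
    apply/matrixP => i j; rewrite !mxE.
    transitivity (dotr (gso (rowq A) i) (gso (rowq A) j)).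
      by apply: eq_bigr => h _; rewrite !mxE.
    have [->|neq_ij] := eqVneq i j; first by rewrite mulr1n.
    rewrite mulr0n; move: neq_ij; rewrite -val_eqE /= neq_ltn => /orP[lt|lt].
      by rewrite dotrC gso_orth.
    by rewrite gso_orth.
  by rewrite det_diag; apply: eq_bigr => i _; rewrite mxE.
rewrite -(ler_int rat) rmorphXn /= -det_map_mx AE det_mulmx detU mul1r detG.
rewrite rmorph_prod /=; apply: ler_prod => i _; rewrite dotr_ge0 /=.
by rewrite -dotr_rowq gsnorm2_le.
Qed.

Lemma row_dotr_gso (m k : nat) (B : 'M[int]_(m, k)) (c : 'rV[int]_m) (i : 'I_m) :
  (forall j : 'I_m, (i < j)%N -> c 0 j = 0) ->
  dotr (map_mx intr (c *m B)) (gso (rowq B) i) = (c 0 i)%:~R * gsnorm2 (rowq B) i.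
Proof.
move=> c0; rewrite mulmx_sum_row raddf_sum /= dotr_suml (bigD1 i) //=.
rewrite map_mxZ -rowqE dotrZl dotr_gso big1 ?addr0 // => j neq_ji.
rewrite map_mxZ -rowqE dotrZl.
have [lt_ji|] := ltnP j i; first by rewrite dotr_gso_lt ?mulr0.
by rewrite leq_eqVlt eq_sym val_eqE (negPf neq_ji) /= => /c0 ->; rewrite mul0r.
Qed.

(** Descending induction: if [c_i] is the last coefficient not yet known to vanish, pairing the
    vector with [b_i^*] gives [c_i |b_i^*|^2]. A nonzero integer [c_i] would then make the vector at
    least as long as [b_i^*], by Cauchy-Schwarz. *)
Lemma short_vector_support (m k : nat) (B : 'M[int]_(m, k)) (c : 'rV[int]_m) (t : nat) :
  (forall i : 'I_m, (t <= i)%N ->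
     (dotr (c *m B) (c *m B))%:~R < gsnorm2 (rowq B) i) ->
  forall i : 'I_m, (t <= i)%N -> c 0 i = 0.
Proof.
move=> big i; have [d] := ubnP (m - i).
elim: d i => // d IHd i lt_d le_ti.
have c0 (j : 'I_m) : (i < j)%N -> c 0 j = 0.
  move=> lt_ij; apply: IHd; last by rewrite (leq_trans le_ti) // ltnW.
  by have := ltn_ord j; lia.
have nrm : dotr (map_mx intr (c *m B)) (map_mx intr (c *m B)) =
    (dotr (c *m B) (c *m B))%:~R :> rat.
  by rewrite rmorph_sum; apply: eq_bigr => j _; rewrite !mxE rmorphM.
have := dotr_cauchy (map_mx intr (c *m B)) (gso (rowq B) i).
rewrite row_dotr_gso // nrm -/(gsnorm2 _ _) => cs.
have big_i := big i le_ti.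
have pos : 0 < gsnorm2 (rowq B) i.
  by apply: le_lt_trans big_i; rewrite ler0z dotr_ge0.
apply/eqP; apply: contraTT cs => c_neq0; rewrite -ltNge.
rewrite exprMn expr2 [_ ^+ 2 in ltRHS]expr2 mulrA ltr_pM2r //.
apply: lt_le_trans big_i _; rewrite ler_peMl ?(ltW pos) //.
rewrite -expr2 -rmorphXn /= ler1z -gtz0_ge1 lt_neqAle sqr_ge0 andbT eq_sym.
by rewrite sqrf_eq0.
Qed.

Lemma sqr_le_of_norm_le_half (R : realFieldType) (u : R) :
  `|u| <= 1 / 2 -> u ^+ 2 <= 1 / 4.
Proof.
by rewrite -real_normK ?num_real //; have := normr_ge0 u; nra.
Qed.

(** Size reduction gives [mu^2 <= 1/4], so the factor in the Lovasz condition is at least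
    [3/4 - 1/4 = 1/2]. *)
Lemma lll_gsnorm2_step (m : nat) (B : 'M[int]_m) (j : nat) : lll_reduced B ->
  (j.+1 < m)%N -> gsnorm2 (rowq B) j <= 2 * gsnorm2 (rowq B) j.+1.
Proof.
case=> mu_le lov lt_jm; have /= := lov j.+1 lt_jm.
have /= := mu_le (Ordinal lt_jm) (Ordinal (ltnW lt_jm)) (ltnSn j).
move/sqr_le_of_norm_le_half; have := dotr_ge0 (gso (rowq B) j).
rewrite -/(gsnorm2 _ _); set x := gsnorm2 _ j; set y := gsnorm2 _ _.
set u := _ ^+ 2 => x0 u_le; have : 0 <= (1 / 4 - u) * x by rewrite mulr_ge0 ?subr_ge0.
by lra.
Qed.

Lemma lll_gsnorm2_le (m : nat) (B : 'M[int]_m) (j i : nat) : lll_reduced B ->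
  (j <= i < m)%N -> gsnorm2 (rowq B) j <= 2 ^+ (i - j) * gsnorm2 (rowq B) i.
Proof.
move=> red /andP[]; elim: i => [|i IHi].
  by rewrite leqn0 => /eqP-> _; rewrite mul1r.
rewrite leq_eqVlt => /orP[/eqP-> _|le_ji lt_im]; first by rewrite subnn mul1r.
apply: le_trans (IHi le_ji (ltnW lt_im)) _.
rewrite subSn // exprSr -mulrA ler_wpM2l ?exprn_ge0 //.
exact: lll_gsnorm2_step.
Qed.

Lemma lll_norm2_le (m : nat) (B : 'M[int]_m) (i : 'I_m) (j : 'I_m) :
  lll_reduced B -> (j <= i)%N ->
  (dotr (row j B) (row j B))%:~R <= 2 ^+ i * gsnorm2 (rowq B) i.
Proof.
move=> red le_ji; rewrite -dotr_rowq gso_pythagoras.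
have gi_ge0 : 0 <= gsnorm2 (rowq B) i by apply: dotr_ge0.
have step (h : nat) : (h <= i)%N ->
    gsnorm2 (rowq B) h <= 2 ^+ (i - h) * gsnorm2 (rowq B) i.
  by move=> le_hi; apply: lll_gsnorm2_le => //; rewrite le_hi ltn_ord.
have mu2 (h : 'I_j) : gsmu (rowq B) j h ^+ 2 <= 1 / 4.
  have lt_hm : (h < m)%N by apply: ltn_trans (ltn_ord j).
  exact: sqr_le_of_norm_le_half (red.1 j (Ordinal lt_hm) (ltn_ord h)).
(* The factor 1/4 from [mu^2] is only used as 1/2: with these terms the geometric sum closes up to
   exactly [2^i]. *)
have sum_le : \sum_(h < j) gsmu (rowq B) j h ^+ 2 * gsnorm2 (rowq B) h
    <= \sum_(h < j) 2 ^+ (i - h.+1) * gsnorm2 (rowq B) i.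
  apply: ler_sum => h _; have := mu2 h; have lt_hi := leq_trans (ltn_ord h) le_ji.
  have := step h (ltnW lt_hi); have := dotr_ge0 (gso (rowq B) h).
  rewrite -/(gsnorm2 _ _) -(subnSK lt_hi) exprS.
  set x := gsnorm2 _ h; set y := gsnorm2 _ _; set u := _ ^+ 2; set e := 2 ^+ _.
  move=> x0 x_le u_le; have : 0 <= (1 / 4 - u) * x by rewrite mulr_ge0 ?subr_ge0.
  have : 0 <= e * y by rewrite mulr_ge0 ?exprn_ge0.
  by lra.
apply: le_trans (lerD (step j le_ji) sum_le) _.
rewrite -mulr_suml -mulrDl ler_wpM2r //.
have {step sum_le mu2} -> : 2 ^+ (i - j) + \sum_(h < j) 2 ^+ (i - h.+1) = 2 ^+ i :> rat.
  move: le_ji; elim: (j : nat) => [|h IHh] lt_hi; first by rewrite big_ord0 subn0 addr0.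
  rewrite big_ord_recr /= addrCA -IHh 1?ltnW // addrC.
  by congr (_ + _); rewrite -(subnSK lt_hi) exprS; ring.
by [].
Qed.

(** * Bounds on resultants and on logarithmic derivatives *)

Definition pnorm2 (R : nzRingType) (p : {poly R}) : R :=
  \sum_(i < size p) p`_i ^+ 2.

Lemma pnorm2_ge0 (R : realDomainType) (p : {poly R}) : 0 <= pnorm2 p.
Proof. by apply: sumr_ge0 => i _; apply: sqr_ge0. Qed.

Lemma sum_sqr_coef_le (R : realDomainType) (p : {poly R}) (d : nat) :
  \sum_(i < d) p`_i ^+ 2 <= pnorm2 p.
Proof.
have [le_dp|/ltnW le_pd] := leqP d (size p).
  rewrite (big_ord_widen _ (fun i => p`_i ^+ 2) le_dp) big_mkcond /=.
  by apply: ler_sum => i _; case: ifP; rewrite ?sqr_ge0.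
rewrite /pnorm2 (big_ord_widen _ (fun i => p`_i ^+ 2) le_pd) [leRHS]big_mkcond /=.
apply: ler_sum => i _; case: ltnP => // /(nth_default 0) ->.
by rewrite expr0n.
Qed.

Lemma sum_sqr_shift_le (R : realDomainType) (p : {poly R}) (d k : nat) :
  \sum_(j < d) (p`_(j - k) *+ (k <= j)) ^+ 2 <= pnorm2 p.
Proof.
rewrite -(big_mkord xpredT (fun j => (p`_(j - k) *+ (k <= j)) ^+ 2)).
have [le_dk|le_kd] := leqP d k.
  rewrite big_nat big1 ?pnorm2_ge0 // => i /andP[_ lt_id].
  by rewrite [(k <= i)%N]leqNgt (leq_trans lt_id) // mulr0n expr0n.
rewrite (big_cat_nat (n := k)) ?(ltnW le_kd) //= big_nat big1 => [|i]; last first.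
  by case/andP=> _ lt_ik; rewrite [(k <= i)%N]leqNgt lt_ik mulr0n expr0n.
rewrite add0r -{1}[k]add0n big_addn big_mkord.
apply: le_trans (sum_sqr_coef_le p (d - k)); apply: ler_sum => i _.
by rewrite addnK leq_addl mulr1n.
Qed.

(** Hadamard's inequality for the Sylvester matrix, whose rows are shifted coefficient lists:
    [deg q] copies of [p] and [deg p] copies of [q]. *)
Lemma resultant_sqr_le (p q : {poly int}) :
  resultant p q ^+ 2 <= pnorm2 p ^+ (size q).-1 * pnorm2 q ^+ (size p).-1.
Proof.
apply: le_trans (hadamard _) _; rewrite big_split_ord /=.
have rowE (u : {poly int}) i k :
    (forall j, Sylvester_mx p q i j = u`_(j - k) *+ (k <= j)) ->
    dotr (row i (Sylvester_mx p q)) (row i (Sylvester_mx p q)) <= pnorm2 u.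
  move=> SE; apply: le_trans (sum_sqr_shift_le u _ k); apply: ler_sum => j _.
  by rewrite mxE SE expr2.
apply: ler_pM; try by apply: prodr_ge0 => i _; apply: dotr_ge0.
- rewrite -[X in _ ^+ X]card_ord -prodr_const; apply: ler_prod => i _.
  rewrite dotr_ge0 /=; apply: (rowE p _ i) => j.
  by rewrite Sylvester_mxE (unsplitK (inl i)).
- rewrite -[X in _ ^+ X]card_ord -prodr_const; apply: ler_prod => i _.
  rewrite dotr_ge0 /=; apply: (rowE q _ i) => j.
  by rewrite Sylvester_mxE (unsplitK (inr i)).
Qed.

(* Horner's rule is run from the top coefficient if [`|x| <= 1], and from the
   bottom one otherwise, so that the coefficients of [f] are never amplified. *)
Lemma coef_quo_linear_le (f u : {poly algC}) (x S : algC) (n : nat) :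
  size f = n.+1 -> f = u * ('X - x%:P) ->
  \sum_(i < n) `|f`_i| <= S -> \sum_(i < n) `|f`_i.+1| <= S ->
  forall k, `|u`_k| <= S.
Proof.
move=> szf fE le0 le1 k.
have u_neq0 : u != 0 by apply/eqP => u0; move: szf; rewrite fE u0 mul0r size_poly0.
have szu : size u = n.
  by move: szf; rewrite fE size_Mmonic ?monicXsubC // size_XsubC addn2 => -[].
have S_ge0 : 0 <= S by apply: le_trans le0; apply: sumr_ge0.
have [le_nk|lt_kn] := leqP n k; first by rewrite nth_default ?szu // normr0.
have f0 : f`_0 = - (x * u`_0) by rewrite fE mulrBr coefB coefMX coefMC sub0r mulrC.
have fS i : f`_i.+1 = u`_i - x * u`_i.+1.
  by rewrite fE mulrBr coefB coefMX coefMC mulrC.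
have [x_le1|x_gt1] := real_leP (normr_real x) (real1 _).
  suff le_u d i : (n <= i + d)%N -> `|u`_i| <= \sum_(i <= j < n) `|f`_j.+1|.
    apply: le_trans (le_u n k (leq_addl _ _)) _; apply: le_trans le1.
    rewrite -(big_mkord xpredT (fun j => `|f`_j.+1|)) [leRHS](big_cat_nat (n := k)) ?(ltnW lt_kn) //=.
    by rewrite lerDr sumr_ge0.
  elim: d i => [|d IHd] i le_nid.
    by rewrite nth_default ?normr0 ?sumr_ge0 // szu; rewrite addn0 in le_nid.
  have [le_ni|lt_in] := leqP n i.
    by rewrite nth_default ?szu // normr0 sumr_ge0.
  rewrite big_ltn //; have -> : u`_i = f`_i.+1 + x * u`_i.+1 by rewrite fS subrK.
  apply: le_trans (ler_normD _ _) _; rewrite lerD2l normrM.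
  apply: le_trans (IHd i.+1 _); last by rewrite addSnnS.
  by rewrite ler_piMl.
suff le_u i : `|u`_i| <= \sum_(j < i.+1) `|f`_j|.
  apply: le_trans (le_u k) _; apply: le_trans le0.
  rewrite (big_ord_widen n (fun j => `|f`_j|)) // big_mkcond /=.
  by apply: ler_sum => i _; case: ifP.
have le_xu j : `|u`_j| <= `|x * u`_j| by rewrite normrM ler_peMl // ltW.
elim: i => [|i IHi]; first by rewrite big_ord1 f0 normrN le_xu.
rewrite big_ord_recr /=; apply: le_trans (le_xu _) _.
have -> : x * u`_i.+1 = u`_i - f`_i.+1 by rewrite fS; ring.
by apply: le_trans (ler_normB _ _) _; rewrite lerD2r.
Qed.

(* With [p] the product of the [X - x], the polynomial [h * p^`()] is the sum
   over [x] of the quotients [f / (X - x)]. *)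
Lemma coef_mul_deriv_prod_le (f h : {poly algC}) (s : seq algC) (S : algC) (n : nat) :
  size f = n.+1 -> f = h * \prod_(x <- s) ('X - x%:P) ->
  \sum_(i < n) `|f`_i| <= S -> \sum_(i < n) `|f`_i.+1| <= S ->
  forall k, `|(h * (\prod_(x <- s) ('X - x%:P))^`())`_k| <= (size s)%:R * S.
Proof.
move=> szf + le0 le1 k; elim: s h => [|x s IHs] h fE.
  by rewrite big_nil derivC mulr0 coef0 normr0 mul0r.
rewrite big_cons derivM mulrDr coefD.
rewrite [leRHS](_ : _ = S + (size s)%:R * S); last by rewrite mulrS mulrDl mul1r.
apply: le_trans (ler_normD _ _) _; apply: lerD.
  apply: coef_quo_linear_le szf _ le0 le1 _.
  by rewrite derivXsubC mul1r fE big_cons (mulrC ('X - _)) mulrA.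
by rewrite mulrA; apply: IHs; rewrite fE big_cons mulrA.
Qed.

(** Over [algC] the factor [G] splits into [deg G] linear factors, each contributing at most [S]
    through one quotient [f / (X - x)]. *)
Lemma coef_logderiv_le (G H : {poly int}) (S : int) (n : nat) :
  size (G * H) = n.+1 ->
  \sum_(i < n) `|(G * H)`_i| <= S -> \sum_(i < n) `|(G * H)`_i.+1| <= S ->
  forall k, `|(H * G^`())`_k| <= (size G).-1%:R * S.
Proof.
pose toC : {poly int} -> {poly algC} := map_poly intr.
move=> szf le0 le1 k; set f := G * H in szf le0 le1.
have [s sE] := closed_field_poly_normal (toC G).
have szC (p : {poly int}) : size (toC p) = size p.
  by rewrite size_map_inj_poly ?rmorph0 //; apply: intr_inj.
have G_neq0 : G != 0 by apply/eqP => G0; move: szf; rewrite /f G0 mul0r size_poly0.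
have szs : size s = (size G).-1.
  rewrite -szC sE size_scale ?size_prod_XsubC //.
  by rewrite lead_coef_eq0 -size_poly_eq0 szC size_poly_eq0.
have absC (z : int) : `|z%:~R| = (`|z|)%:~R :> algC by rewrite intr_norm.
rewrite -(ler_int algC) rmorphM /= rmorph_nat -absC -szs -coef_map /=.
rewrite -[map_poly _ _]/(toC _) (_ : toC _ = toC H * (toC G)^`()); last first.
  by rewrite /toC deriv_map rmorphM.
(* The leading coefficient of [G] moves into the cofactor, leaving a monic product of linear
   factors. *)
rewrite {1}sE derivZ -scalerAr scalerAl.
apply: (@coef_mul_deriv_prod_le (toC f) _ s S%:~R n); rewrite ?szC //.
- by rewrite -scalerAl scalerAr -sE /toC rmorphM mulrC.
- rewrite -(ler_int algC) rmorph_sum /= in le0; apply: le_trans le0.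
  by rewrite le_eqVlt; apply/orP/or_introl/eqP/eq_bigr => i _; rewrite -absC coef_map.
- rewrite -(ler_int algC) rmorph_sum /= in le1; apply: le_trans le1.
  by rewrite le_eqVlt; apply/orP/or_introl/eqP/eq_bigr => i _; rewrite -absC coef_map.
Qed.

(** Each sum omits one end coefficient, so it has [n] terms and Cauchy-Schwarz costs the factor [n],
    not [n + 1]. *)
Lemma coef_sum_bound (f : {poly int}) (n : nat) : size f = n.+1 ->
  exists S : int, [/\ \sum_(i < n) `|f`_i| <= S, \sum_(i < n) `|f`_i.+1| <= S
    & S ^+ 2 <= n%:R * pnorm2 f].
Proof.
move=> szf; pose S0 := \sum_(i < n) `|f`_i|; pose S1 := \sum_(i < n) `|f`_i.+1|.
exists (Num.max S0 S1); rewrite !le_max !lexx orbT; split=> //.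
have le_sum : \sum_(i < n) f`_i.+1 ^+ 2 <= pnorm2 f.
  by rewrite /pnorm2 szf big_ord_recl lerDr sqr_ge0.
case: (leP S0 S1) => _; apply: le_trans (sqr_sum_le _) _; rewrite ler_wpM2l ?ler0n //.
  by apply: le_trans le_sum; apply: ler_sum => i _; rewrite real_normK ?num_real.
apply: le_trans (sum_sqr_coef_le f n); apply: ler_sum => i _.
by rewrite real_normK ?num_real.
Qed.

(** * Logarithmic derivatives in a product of monic polynomials *)

Lemma deriv_prod (R : comNzRingType) (I : finType) (P : pred I) (q : I -> {poly R}) :
  (\prod_(i | P i) q i)^`() =
  \sum_(i | P i) (q i)^`() * \prod_(j | P j && (j != i)) q j.
Proof.
elim: (index_enum I) (index_enum_uniq I) => [|x s IHs] /=.
  by rewrite !big_nil derivC.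
case/andP=> xs uniq_s; rewrite big_cons [RHS]big_cons.
have prod_x : \prod_(j <- x :: s | P j && (j != x)) q j = \prod_(j <- s | P j) q j.
  rewrite big_cons eqxx andbF big_seq_cond [RHS]big_seq_cond.
  by apply: eq_bigl => j; case: eqP => [->|_]; rewrite ?andbT // (negPf xs).
have sum_s : P x -> \sum_(i <- s | P i) (q i)^`() *
      (\prod_(j <- x :: s | P j && (j != i)) q j) = q x * (\prod_(i <- s | P i) q i)^`().
  move=> Px; rewrite IHs // mulr_sumr big_seq_cond [RHS]big_seq_cond.
  apply: eq_bigr => i /andP[si Pi]; rewrite big_cons Px /=.
  by case: eqP => [xi|_ /=]; [rewrite xi si in xs | rewrite mulrCA].
case Px: (P x); first by rewrite derivM prod_x sum_s.
rewrite IHs // big_seq_cond [RHS]big_seq_cond; apply: eq_bigr => i _.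
by rewrite big_cons Px.
Qed.

Lemma monic_dvd_const (R : comNzRingType) (q K : {poly R}) (c : R) :
  q \is monic -> (1 < size q)%N -> q * K = c%:P -> c = 0.
Proof.
move=> q_mon q_gt1 qK; have [K0|K0] := eqVneq K 0.
  by move: qK; rewrite K0 mulr0 => /esym/eqP; rewrite polyC_eq0 => /eqP.
have := size_polyC_leq1 c; rewrite -qK size_monicM //.
by move: K0 q_gt1; rewrite -size_poly_eq0; lia.
Qed.

Section FactorLogDerivatives.
Variables (R : comNzRingType) (r : nat) (Q : 'I_r -> {poly R}) (c0 : R).
Hypothesis Q_monic : forall i, Q i \is monic.
Let f := c0 *: \prod_i Q i.

(** This is [Phi (Q i)], that is [f (Q i)' / Q i], written without a division. *)
Definition logderiv (i : 'I_r) : {poly R} :=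
  c0 *: ((Q i)^`() * \prod_(j | j != i) Q j).

Lemma mul_logderiv i : Q i * logderiv i = f * (Q i)^`().
Proof.
rewrite /f /logderiv [\prod_i _](bigD1 i) //= -scalerAr -scalerAl; congr (_ *: _).
by ring.
Qed.

Lemma deriv_logderiv : f^`() = \sum_i logderiv i.
Proof. by rewrite derivZ deriv_prod scaler_sumr; apply: eq_bigr. Qed.

(** Every [logderiv j] with [j != i] contains the factor [Q i]; hence only the [i]-th term of a
    combination survives modulo [Q i]. *)
Lemma dvd_sum_logderiv i (y : 'I_r -> R) :
  exists K, \sum_(j | j != i) y j *: logderiv j = Q i * K.
Proof.
exists (\sum_(j | j != i)
  (y j * c0) *: ((Q j)^`() * \prod_(h | (h != j) && (h != i)) Q h)).
rewrite mulr_sumr; apply: eq_bigr => j neq_ji.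
rewrite /logderiv scalerA (bigD1 i) 1?eq_sym //= -scalerAr; congr (_ *: _).
by ring.
Qed.

(** Additivity of [Phi] on products. Cancelling the monic product over [P] identifies [c *: K] with
    [c0] times the product of the remaining factors. *)
Lemma logderiv_factor (P : pred 'I_r) (c : R) (K : {poly R}) :
  f = (c *: \prod_(i | P i) Q i) * K ->
  K * (c *: \prod_(i | P i) Q i)^`() = \sum_(i | P i) logderiv i.
Proof.
move=> fE; have cK : c *: K = c0 *: \prod_(i | ~~ P i) Q i.
  have monP : \prod_(i | P i) Q i \is monic by apply: monic_prod.
  apply: (monic_lreg monP); rewrite -scalerAr scalerAl -fE /f (bigID P) /=.
  by rewrite scalerAr.
rewrite derivZ -scalerAr scalerAl cK deriv_prod mulr_sumr; apply: eq_bigr => i Pi.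
rewrite /logderiv -scalerAl mulrCA; congr (_ *: (_ * _)).
rewrite [RHS](bigID P) mulrC /=; congr (_ * _); apply: eq_bigl => j.
  by rewrite andbC.
by case: eqP => [->|_]; rewrite ?Pi.
Qed.

Lemma size_logderiv n i : (size f <= n.+1)%N -> (size (logderiv i) <= n)%N.
Proof.
move=> szf; have [->|L0] := eqVneq (logderiv i) 0; first by rewrite size_poly0.
have := size_polyMleq f (Q i)^`(); rewrite -mul_logderiv size_monicM //.
have := lt_size_deriv (monic_neq0 (Q_monic i)).
have : (0 < size (Q i))%N by rewrite lt0n size_poly_eq0 monic_neq0.
by move: L0; rewrite -size_poly_eq0; lia.
Qed.

(* Modulo [Q i], [logderiv i] is [f^`()], which the Bezout relation inverts up
   to a nilpotent perturbation. *)
Lemma logderiv_regular (U V E : {poly R}) (e : R) (l : nat) (i : 'I_r) (K : {poly R}) (c : R) :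
  e ^+ l = 0 -> U * f + V * f^`() = 1 + e *: E -> (1 < size (Q i))%N ->
  c *: logderiv i = Q i * K -> c = 0.
Proof.
move=> el0 bez Qi_gt1 cL.
have [K1 derE] : exists K1, f^`() = logderiv i + Q i * K1.
  have [K1 K1E] := dvd_sum_logderiv i (fun=> 1); exists K1.
  rewrite deriv_logderiv (bigD1 i) //= -K1E; congr (_ + _).
  by apply: eq_bigr => j _; rewrite scale1r.
have [K0 fE] : exists K0, f = Q i * K0.
  by exists (c0 *: \prod_(j | j != i) Q j); rewrite /f (bigD1 i) //= scalerAr.
have cE : c *: (1 + e *: E) = Q i * (c *: (U * K0 + V * K1) + V * K).
  rewrite -bez derE fE -!mul_polyC; rewrite -mul_polyC in cL.
  transitivity (Q i * (c%:P * (U * K0 + V * K1)) + V * (c%:P * logderiv i)).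
    by ring.
  by rewrite cL; ring.
(* As [e^l = 0], the truncated geometric series inverts [1 + e E], so the constant [c] itself
   becomes a multiple of [Q i]. *)
have geo : (1 + e *: E) * \sum_(j < l) (- (e *: E)) ^+ j = 1.
  have := subrX1 (- (e *: E)) l; rewrite -scalerN exprZn el0 scale0r sub0r scalerN.
  by move=> h; rewrite -[RHS]opprK h -mulNr opprD !opprK addrC.
apply: (@monic_dvd_const _ (Q i)
  ((c *: (U * K0 + V * K1) + V * K) * \sum_(j < l) (- (e *: E)) ^+ j)) => //.
by rewrite mulrA -cE -scalerAl geo alg_polyC.
Qed.

End FactorLogDerivatives.

(** * Reduction modulo [v^l] *)

Lemma Zp_intr_eq0 (p : nat) (z : int) :
  (1 < p)%N -> (z%:~R == 0 :> 'Z_p) = (p%:Z %| z)%Z.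
Proof.
move=> p_gt1; have nat_case (x : nat) : (x%:R == 0 :> 'Z_p) = (p %| x)%N.
  by rewrite -(inj_eq val_inj) /= val_Zp_nat.
case: z => x; first by rewrite -pmulrn nat_case.
by rewrite NegzE mulrNz oppr_eq0 -pmulrn nat_case dvdzE.
Qed.

Lemma Fp_intr_eq0 (p : nat) (z : int) :
  prime p -> (z%:~R == 0 :> 'F_p) = (p%:Z %| z)%Z.
Proof.
move=> p_pr; have nat_case (x : nat) : (x%:R == 0 :> 'F_p) = (p %| x)%N.
  by rewrite -(dvdn_pcharf (pchar_Fp p_pr)).
case: z => x; first by rewrite -pmulrn nat_case.
by rewrite NegzE mulrNz oppr_eq0 -pmulrn nat_case dvdzE.
Qed.

Section Reduction.
Variables (R : comNzRingType) (m : int).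
Hypothesis intr_eq0 : forall z : int, (z%:~R == 0 :> R) = (m %| z)%Z.
Local Notation red := (map_poly (intr : int -> R)).

Lemma intr_modz (x y : int) : (m %| x - y)%Z -> x%:~R = y%:~R :> R.
Proof. by rewrite -intr_eq0 intrB subr_eq0 => /eqP. Qed.

Lemma red_pcong (p q : {poly int}) : pcong m p q -> red p = red q.
Proof. by move=> pq; apply/polyP => i; rewrite !coef_map /=; apply/intr_modz/pq. Qed.

Lemma red_eq0 (p : {poly int}) : red p = 0 -> exists E, p = m *: E.
Proof.
move=> p0; exists (\poly_(i < size p) (p`_i %/ m)%Z); apply/polyP => i.
rewrite coefZ coef_poly; case: ltnP => [_|/(nth_default 0) ->]; last by rewrite mulr0.
rewrite mulrC divzK // -intr_eq0; move/polyP/(_ i): p0.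
by rewrite coef_map coef0 => ->.
Qed.

Lemma size_red_monic (q : {poly int}) : q \is monic -> size (red q) = size q.
Proof. by move=> /monicP q1; rewrite size_map_poly_id0 // q1 rmorph1 oner_neq0. Qed.

Lemma monic_red (q : {poly int}) : q \is monic -> red q \is monic.
Proof.
move=> q_mon; rewrite monicE lead_coefE size_red_monic // coef_map /=.
by rewrite -lead_coefE (monicP q_mon).
Qed.

(** The difference of the reduced quotient and [L], times the monic [red q], is minus the reduced
    remainder; its degree is below that of [q], so the difference is 0. *)
Lemma red_divp (p q : {poly int}) (L : {poly R}) : q \is monic ->
  red p = red q * L -> red (p %/ q) = L.
Proof.
move=> q_mon pqL; have := congr1 (fun u => red u) (Pdiv.IdomainMonic.divp_eq q_mon p).
rewrite rmorphD rmorphM /= pqL => /(canLR (addrK _)) remE.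
have {remE} : red q * (red (p %/ q) - L) = - red (p %% q).
  by rewrite mulrBr (mulrC (red q) (red _)) -remE; ring.
have [/eqP|quo_neq0] := eqVneq (red (p %/ q) - L) 0; first by rewrite subr_eq0 => /eqP.
move/(congr1 (size \o @polyseq _)) => /=.
rewrite size_polyN size_monicM ?monic_red // size_red_monic // => szE.
have szr : (size (red (p %% q)%R) <= size (p %% q)%R)%N by apply: size_poly.
have := leq_ltn_trans szr (Pdiv.Idomain.ltn_modpN0 p (monic_neq0 q_mon)).
move: quo_neq0; rewrite -size_poly_eq0 -szE; case: (size _) => // k _.
by rewrite addnS /= ltnNge leq_addr.
Qed.

(** Since [m] divides the numerator of [d], it is coprime to the denominator, which can therefore be
    cancelled in the integer relation [GcE]. *)
Lemma red_of_numq (p : {poly rat}) (G q : {poly int}) (c : int) :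
  (forall i, (m %| numq (p`_i - (q`_i)%:~R))%Z) ->
  map_poly intr G = c%:~R *: p -> red G = c%:~R *: red q.
Proof.
move=> numq_dvd GE; apply/polyP => i; rewrite coefZ !coef_map /= -intrM.
apply: intr_modz; have := numq_dvd i; set d := p`_i - _ => m_num.
have GcE : ((G`_i - c * q`_i) * denq d)%:~R = (c * numq d)%:~R :> rat.
  rewrite !intrM numqE mulrA intrB -coef_map GE coefZ /= intrM.
  by rewrite /d mulrBr.
have co : coprimez m (denq d) by apply: coprimez_dvdl m_num _; apply: coprime_num_den.
by rewrite -(Gauss_dvdzl _ co) (intr_inj GcE) dvdz_mull.
Qed.

End Reduction.

Lemma dvdz_sqr_le (m z : int) : (m %| z)%Z -> z != 0 -> m ^+ 2 <= z ^+ 2.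
Proof.
move/dvdzP=> [u ->]; rewrite mulf_eq0 negb_or => /andP[u0 _].
rewrite exprMn ler_peMl ?sqr_ge0 // -gtz0_ge1 lt_neqAle sqr_ge0 andbT eq_sym.
by rewrite sqrf_eq0.
Qed.

Lemma pnorm2_ge1 (p : {poly int}) : p != 0 -> 1 <= pnorm2 p.
Proof.
move=> p0; rewrite -gtz0_ge1 lt_neqAle pnorm2_ge0 andbT eq_sym.
apply: contra p0; rewrite psumr_eq0 => [/allP all0|i _]; last exact: sqr_ge0.
have [//|] := eqVneq p 0; rewrite -lead_coef_eq0 lead_coefE => lc0.
have szp : ((size p).-1 < size p)%N.
  rewrite prednK ?leqnn // lt0n size_poly_eq0.
  by apply: contra lc0 => /eqP->; rewrite coef0.
by have := all0 (Ordinal szp) (mem_index_enum _); rewrite /= sqrf_eq0 (negPf lc0).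
Qed.

(** The resultant lies in the ideal of [f] and [h], so modulo [m] it is a constant divisible by [q],
    hence 0. As a nonzero multiple of [m] it is at least [m] in absolute value, while Hadamard
    bounds it from above. *)
Lemma resultant_lower_bound (R : comNzRingType) (m : int) (f h : {poly int})
    (q K1 K2 : {poly R}) (n : nat) :
  (forall z : int, (z%:~R == 0 :> R) = (m %| z)%Z) ->
  q \is monic -> (1 < size q)%N ->
  map_poly intr f = q * K1 -> map_poly intr h = q * K2 ->
  size f = n.+1 -> (0 < n)%N -> (size h <= n)%N -> resultant f h != 0 ->
  m ^+ 2 <= pnorm2 f ^+ n * pnorm2 h ^+ n.
Proof.
move=> hm q_mon q_gt1 fK hK szf n_gt0 szh res_neq0.
have f_neq0 : f != 0 by rewrite -size_poly_eq0 szf.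
have h_neq0 : h != 0.
  by apply: contraNneq res_neq0 => ->; rewrite resultant_eq0 gcdp0 szf ltnS.
have f_ge1 := pnorm2_ge1 f_neq0; have h_ge1 := pnorm2_ge1 h_neq0.
have [h_gt1|h_le1] := ltnP 1 (size h).
  have [|u _ resE] := resultant_in_ideal (p := f) (q := h) _ h_gt1.
    by rewrite szf ltnS.
  have m_res : (m %| resultant f h)%Z.
    rewrite -hm; apply/eqP; apply: (@monic_dvd_const _ q
      (map_poly intr u.1 * K1 + map_poly intr u.2 * K2)) => //.
    rewrite -(map_polyC (intr : {rmorphism int -> R})) /= resE rmorphD !rmorphM /= fK hK.
    by ring.
  apply: le_trans (dvdz_sqr_le m_res res_neq0) _.
  apply: le_trans (resultant_sqr_le f h) _; rewrite szf /= ler_wpM2r //.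
    by rewrite exprn_ge0 // pnorm2_ge0.
  by apply: ler_weXn2l => //; rewrite -ltnS (leq_trans _ (leqW szh)) // prednK // (ltnW h_gt1).
(* A constant [h] is itself divisible by [q] modulo [m], so [h] takes the role of the resultant. *)
have hC := size1_polyC h_le1.
have m_h : (m %| h`_0)%Z.
  rewrite -hm; apply/eqP; apply: (@monic_dvd_const _ q K2) => //.
  by rewrite -hK {1}hC map_polyC.
have h0_neq0 : h`_0 != 0 by rewrite -polyC_eq0 -hC.
apply: le_trans (dvdz_sqr_le m_h h0_neq0) _.
have hE : pnorm2 h = h`_0 ^+ 2.
  rewrite /pnorm2; have -> : size h = 1%N; last by rewrite big_ord1.
  by apply/eqP; rewrite eqn_leq h_le1 lt0n size_poly_eq0.
rewrite -hE; apply: le_trans (_ : pnorm2 h ^+ n <= _).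
  by rewrite -{1}[pnorm2 h]expr1; apply: ler_weXn2l.
by rewrite ler_peMl ?exprn_ge0 ?pnorm2_ge0 // exprn_ege1.
Qed.

(** Coefficientwise lift of a Bezout relation over [F_p]. The error [p E] becomes nilpotent modulo a
    power of [p]. *)
Lemma bezout_mod_prime (p : nat) (f : {poly int}) : prime p ->
  separable_poly (map_poly (intr : int -> 'F_p) f) ->
  exists U V E : {poly int}, U * f + V * f^`() = 1 + p%:Z *: E.
Proof.
move=> p_pr; set fb := map_poly _ f; rewrite unlock => /Bezout_coprimepP[u].
rewrite -size_poly_eq1 => /size_poly1P[c c_neq0 bez].
pose lift (q : {poly 'F_p}) : {poly int} := map_poly (fun x : 'F_p => (x : nat)%:Z) q.
have liftK q : map_poly intr (lift q) = q.
  by apply/polyP => i; rewrite coef_map coef_map_id0 //= -pmulrn natr_Zp.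
pose U := lift (c^-1 *: u.1); pose V := lift (c^-1 *: u.2).
have [|E UVE] := red_eq0 (R := 'F_p) (fun z => Fp_intr_eq0 z p_pr)
    (p := U * f + V * f^`() - 1).
  rewrite rmorphB rmorphD !rmorphM rmorph1 /= !liftK -deriv_map -/fb.
  rewrite -!scalerAl -scalerDr bez -mul_polyC -polyCM mulVf //.
  by rewrite subrr.
by exists U, V, E; rewrite -UVE [RHS]addrC subrK.
Qed.

(** By separability [q i] is coprime to the product of the other factors. An index in no support
    would make the whole product coprime to [q i]; an index in two supports would put a second copy
    of [q i] into the cofactor. *)
Lemma squarefree_prod_partition (K : fieldType) (r s : nat) (q : 'I_r -> {poly K})
    (c : K) (w : 'I_s -> 'I_r -> bool) :
  separable_poly (c *: \prod_i q i) -> c != 0 -> (forall i, (1 < size (q i))%N) ->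
  \prod_j \prod_(i | w j i) q i = \prod_i q i ->
  forall i, exists j, w j i /\ forall j', w j' i -> j' = j.
Proof.
move=> sep c0 q_gt1 prodE i; have q_neq0 : q i != 0.
  by rewrite -size_poly_eq0; have := q_gt1 i; case: size.
have co : coprimep (q i) (\prod_(j | j != i) q j).
  by apply: (separable_coprime sep); rewrite dvdpZr // [\prod_(i : 'I_r) _](bigD1 i).
have co_self p : ~ coprimep (q i) (q i * p).
  by rewrite coprimepMr coprimepp => /andP[/eqP sz1 _]; have := q_gt1 i; rewrite sz1.
have [j wji|no_w] := pickP (w ^~ i); last first.
  case: (co_self (\prod_(j | j != i) q j)).
  have -> : q i * \prod_(j | j != i) q j = \prod_j \prod_(i | w j i) q i.
    by rewrite prodE [RHS](bigD1 i).
  elim/big_rec: _ => [|j p _ co_p]; first by rewrite coprimep1.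
  rewrite coprimepMr co_p andbT.
  elim/big_rec: _ => [|h p' wjh co_p']; first by rewrite coprimep1.
  rewrite coprimepMr co_p' andbT; apply: coprimep_dvdl co.
  rewrite (bigD1 h) ?dvdp_mulIl //; apply: contraTneq wjh => ->.
  by rewrite no_w.
exists j; split=> // j' wj'i; apply/eqP; apply/negPn/negP => neq_jj'.
case: (co_self (\prod_(h | w j h && (h != i)) q h *
  ((\prod_(h | w j' h && (h != i)) q h) *
   \prod_(k | (k != j) && (k != j')) \prod_(i | w k i) q i))).
move: co; set P := \prod_(j | j != i) q j; set X := q i * _.
suff -> : P = X by [].
apply: (mulfI q_neq0); transitivity (\prod_i q i); first by rewrite [RHS](bigD1 i).
rewrite -prodE (bigD1 j) //= (bigD1 j') //= (bigD1 i) //= [X in _ * (X * _)](bigD1 i) //=.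
by rewrite /X; ring.
Qed.

(** * Recombination of the local factors *)

Lemma sqr_sub_le (R : realDomainType) (x y : R) :
  (x - y) ^+ 2 <= 2 * x ^+ 2 + 2 * y ^+ 2.
Proof.
rewrite -subr_ge0 [leRHS](_ : _ = (x + y) ^+ 2) ?sqr_ge0 //.
by ring.
Qed.

Lemma size_mul_deriv_le (R : idomainType) (p q : {poly R}) :
  (size (q * p^`())%R <= (size (p * q)%R).-1)%N.
Proof.
have [->|p0] := eqVneq p 0; first by rewrite derivC mulr0 size_poly0.
have [->|q0] := eqVneq q 0; first by rewrite mul0r size_poly0.
have aux (x y z : nat) : (0 < x -> y < z -> (x + y).-1 <= (z + x).-1.-1)%N by lia.
apply: leq_trans (size_polyMleq _ _) _; rewrite size_mul //.
by apply: aux; rewrite ?lt0n ?size_poly_eq0 ?lt_size_deriv.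
Qed.

Lemma pnorm2_sub_le (p y : {poly int}) (n : nat) (M Y : int) :
  (size (p - y)%R <= n)%N -> pnorm2 p <= M -> (forall k, y`_k ^+ 2 <= Y) ->
  pnorm2 (p - y) <= 2 * M + 2 * (n%:R * Y).
Proof.
move=> szd p_le y_le; rewrite /pnorm2.
rewrite (big_ord_widen _ (fun i => (p - y)`_i ^+ 2) szd) big_mkcond /=.
apply: le_trans (_ : \sum_(i < n) (2 * p`_i ^+ 2 + 2 * Y) <= _).
  apply: ler_sum => i _; case: ifP => _.
    rewrite coefB; apply: le_trans (sqr_sub_le _ _) _.
    by rewrite lerD2l ler_wpM2l.
  apply: addr_ge0; apply: mulr_ge0 => //; first exact: sqr_ge0.
  exact: le_trans (sqr_ge0 _) (y_le 0%N).
rewrite big_split /= sumr_const card_ord -mulr_sumr lerD //.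
  by rewrite ler_wpM2l // (le_trans (sum_sqr_coef_le _ _)).
by rewrite -[_ *+ n]mulr_natl mulrCA.
Qed.

Lemma sqr_bounded_sum_le (s : nat) (c : 'I_s -> int) (d : 'I_s -> nat) (M : int) :
  0 <= M -> (forall j, c j ^+ 2 <= M) ->
  (\sum_j `|c j| * (d j)%:R) ^+ 2 <= M * (\sum_j d j)%:R ^+ 2.
Proof.
move=> M_ge0 c_le; pose C := \big[Num.max/0]_j `|c j|.
have cC j : `|c j| <= C by apply: le_bigmax.
have C2 : C ^+ 2 <= M.
  apply: (big_ind (fun z : int => z ^+ 2 <= M)); first by rewrite expr0n.
    by move=> y z yM zM; rewrite maxEle; case: ifP.
  by move=> j _; rewrite real_normK ?num_real.
apply: le_trans (_ : (C * (\sum_j d j)%:R) ^+ 2 <= _); last first.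
  by rewrite exprMn ler_wpM2r ?sqr_ge0.
rewrite lerXn2r ?nnegrE ?sumr_ge0 ?mulr_ge0 ?ler0n //.
- by move=> j _; rewrite mulr_ge0.
- by rewrite /C; apply: bigmax_ge_id.
by rewrite natr_sum mulr_sumr; apply: ler_sum => j _; rewrite ler_wpM2r ?ler0n.
Qed.

Section Recombination.
Variables (R : comNzRingType) (v l : nat) (f : {poly int}) (n r s : nat).
Variables (Q : 'I_r -> {poly R}) (c0 : R) (U V E : {poly int}).
Variables (G H : 'I_s -> {poly int}) (a : rat) (J : 'I_r -> 'I_s).
Local Notation m := (v%:Z ^+ l).
Local Notation red := (map_poly (intr : int -> R)).
Local Notation toQ := (map_poly (intr : int -> rat)).
Hypothesis red_eq0_dvd : forall z : int, (z%:~R == 0 :> R) = (m %| z)%Z.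
Hypotheses (size_f : size f = n.+1) (n_gt0 : (0 < n)%N).
Hypotheses (Q_monic : forall i, Q i \is monic) (Q_gt1 : forall i, (1 < size (Q i))%N).
Hypothesis red_f : red f = c0 *: \prod_i Q i.
Hypothesis lead_f : coprimez m (lead_coef f).
Hypothesis bezout_f : U * f + V * f^`() = 1 + v%:Z *: E.
Hypothesis sep_f : separable_poly (toQ f).
Hypothesis fGH : forall j, f = G j * H j.
Hypothesis G_irr : forall j, irreducible_poly (toQ (G j)).
Hypothesis f_prod : toQ f = a *: \prod_j toQ (G j).
Hypothesis red_G :
  forall j, red (G j) = (lead_coef (G j))%:~R *: \prod_(i | J i == j) Q i.

(** This is [f (G j)' / G j], unchanged when [G j] is rescaled, hence an integral form of
    [Phi (g_j)]. *)
Let Phi j := H j * (G j)^`().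

Let f_neq0 : f != 0.
Proof. by rewrite -size_poly_eq0 size_f. Qed.

Let G_neq0 j : G j != 0.
Proof. by apply: contraNneq f_neq0 => G0; rewrite (fGH j) G0 mul0r. Qed.

Let H_neq0 j : H j != 0.
Proof. by apply: contraNneq f_neq0 => H0; rewrite (fGH j) H0 mulr0. Qed.

Let lead_G j : coprimez m (lead_coef (G j)).
Proof.
by have := lead_f; rewrite (fGH j) lead_coefM coprimezMr => /andP[].
Qed.

Lemma red_Phi j : red (Phi j) = \sum_(i | J i == j) logderiv Q c0 i.
Proof.
rewrite rmorphM /= -deriv_map red_G; apply: logderiv_factor => //.
by rewrite -red_f -red_G -rmorphM -fGH.
Qed.

Lemma size_Phi j : (size (Phi j) <= n)%N.
Proof.
by have := size_mul_deriv_le (G j) (H j); rewrite -fGH size_f.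
Qed.

Lemma sum_size_G : (\sum_j (size (G j)).-1)%N = n.
Proof.
have a_neq0 : a != 0.
  apply/eqP => a0; have := size_rat_int_poly f.
  by rewrite f_prod a0 scale0r size_poly0 size_f.
have := congr1 (size \o @polyseq _) f_prod; rewrite /= size_rat_int_poly size_f.
rewrite size_scale // size_prod => [|j _]; last first.
  by rewrite -size_poly_eq0 size_rat_int_poly size_poly_eq0.
have -> : (\sum_j size (toQ (G j)) = \sum_j (size (G j)).-1 + s)%N.
  rewrite -[X in (_ + X)%N]card_ord -sum1_card -big_split /=; apply: eq_bigr => j _.
  by rewrite size_rat_int_poly addn1 prednK // lt0n size_poly_eq0.
by rewrite card_ord -addSn addnK => -[].
Qed.

(** Each coefficient of [Phi j] is at most [deg (G j)] times [S], and these degrees add up to [n];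
    the number of rational factors thus does not enter. The square is at most [M n^2 S^2] with
    [S^2 <= n N]. *)
Lemma coef_sum_Phi_le (c : 'I_s -> int) (M : int) (k : nat) :
  0 <= M -> (forall j, c j ^+ 2 <= M) ->
  (\sum_j c j *: Phi j)`_k ^+ 2 <= M * n%:R ^+ 3 * pnorm2 f.
Proof.
move=> M_ge0 c_le; have [S [S0 S1 S2]] := coef_sum_bound size_f.
have S_ge0 : 0 <= S by apply: le_trans S0; apply: sumr_ge0.
have Phi_le j : `|(Phi j)`_k| <= (size (G j)).-1%:R * S.
  by apply: (@coef_logderiv_le _ _ S n); rewrite -fGH.
have le1 : `|(\sum_j c j *: Phi j)`_k| <= (\sum_j `|c j| * (size (G j)).-1%:R) * S.
  rewrite coef_sum mulr_suml; apply: le_trans (ler_norm_sum _ _ _) _.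
  by apply: ler_sum => j _; rewrite coefZ normrM -mulrA ler_wpM2l.
have := sqr_bounded_sum_le (fun j => (size (G j)).-1) M_ge0 c_le.
rewrite sum_size_G; set T := \sum_j `|c j| * _ in le1 *; move=> T2.
rewrite -real_normK ?num_real //; apply: le_trans (_ : (T * S) ^+ 2 <= _).
  by rewrite lerXn2r ?nnegrE // mulr_ge0 // sumr_ge0 // => j _; rewrite mulr_ge0.
rewrite exprMn; apply: le_trans (ler_pM _ _ T2 S2) _; rewrite ?sqr_ge0 //.
by rewrite le_eqVlt; apply/orP/or_introl/eqP; ring.
Qed.

Lemma pnorm2_Phi_le j : pnorm2 (Phi j) <= n%:R ^+ 4 * pnorm2 f.
Proof.
have PhiE : Phi j = \sum_k (k == j)%:R *: Phi k.
  rewrite (bigD1 j) //= eqxx scale1r big1 ?addr0 // => k /negPf->.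
  by rewrite scale0r.
have coef_le k : (Phi j)`_k ^+ 2 <= n%:R ^+ 3 * pnorm2 f.
  rewrite PhiE -[leRHS]mul1r mulrA; apply: coef_sum_Phi_le => // i.
  by case: (i == j); rewrite ?expr1n ?expr0n.
rewrite /pnorm2 (big_ord_widen _ (fun i => (Phi j)`_i ^+ 2) (size_Phi j)) big_mkcond /=.
apply: le_trans (_ : \sum_(i < n) n%:R ^+ 3 * pnorm2 f <= _).
  apply: ler_sum => i _; case: ifP => _; rewrite ?coef_le //.
  by rewrite mulr_ge0 ?pnorm2_ge0 // exprn_ge0.
by rewrite sumr_const card_ord (exprS _ 3) -mulrA mulr_natl.
Qed.

(** With an empty fibre, [red (G j)] would be constant, although the leading coefficient of the
    nonconstant [G j] is a unit modulo [m]. *)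
Lemma J_surj j : exists i, J i = j.
Proof.
have [i /eqP Ji|no_i] := pickP (fun i => J i == j); first by exists i.
have [/= G_gt1 _] := G_irr j; rewrite size_rat_int_poly in G_gt1.
have := congr1 (fun p : {poly R} => p`_(size (G j)).-1) (red_G j).
rewrite big_pred0 // coef_map /= -lead_coefE alg_polyC coefC.
case: eqP => [sz1|_ lead0]; first by move: (G_gt1); rewrite -(prednK (ltnW G_gt1)) sz1.
have m_lead : (m %| lead_coef (G j) * 1)%Z.
  by rewrite mulr1 -red_eq0_dvd; apply/eqP.
by move: m_lead; rewrite Gauss_dvdzr // -red_eq0_dvd oner_eq0.
Qed.

Lemma dvd_Phi j h : j != h -> toQ (G j) %| toQ (Phi h).
Proof.
move=> neq_jh; rewrite /Phi rmorphM /=; apply: dvdp_mulr.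
have GQ_neq0 : toQ (G h) != 0.
  by rewrite -size_poly_eq0 size_rat_int_poly size_poly_eq0.
have -> : toQ (H h) = a *: \prod_(i | i != h) toQ (G i).
  apply: (mulfI GQ_neq0); rewrite -rmorphM /= -fGH f_prod (bigD1 h) //=.
  by rewrite scalerAr.
by rewrite (bigD1 j) //= -mul_polyC dvdp_mull // dvdp_mulr.
Qed.

(** Otherwise [G j] would divide [f' = Phi j + G j (H j)'] as well as [f], against separability. *)
Lemma ndvd_Phi j : ~~ (toQ (G j) %| toQ (Phi j)).
Proof.
apply/negP => dvdPhi; have [G_gt1 _] := G_irr j.
have dvdf' : toQ (G j) %| (toQ f)^`().
  rewrite (fGH j) deriv_map derivM rmorphD !rmorphM /= dvdp_add //.
    by rewrite mulrC -rmorphM.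
  exact: dvdp_mulIl.
have : toQ (G j) %| gcdp (toQ f) (toQ f)^`().
  by rewrite dvdp_gcd dvdf' andbT (fGH j) rmorphM dvdp_mulIl.
have : coprimep (toQ f) (toQ f)^`() by have := sep_f; rewrite unlock.
move=> /eqP sz1 /dvdp_leq; rewrite -size_poly_eq0 sz1 => /(_ isT).
by rewrite leqNgt G_gt1.
Qed.

Lemma resultant_neq0 (h : {poly int}) :
  (forall j, ~~ (toQ (G j) %| toQ h)) -> resultant f h != 0.
Proof.
move=> ndvd; have co : coprimep (toQ f) (toQ h).
  rewrite f_prod; have a_neq0 : a != 0.
    apply/eqP => a0; have := size_rat_int_poly f.
    by rewrite f_prod a0 scale0r size_poly0 size_f.
  rewrite coprimepZl //; elim/big_rec: _ => [|j p _ co_p]; first exact: coprime1p.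
  by rewrite coprimepMl co_p andbT irreducible_poly_coprime.
rewrite resultant_eq0 -leqNgt -size_rat_int_poly.
have : toQ (gcdp f h) %| gcdp (toQ f) (toQ h).
  by rewrite dvdp_gcd !dvdp_rat_int dvdp_gcdl dvdp_gcdr.
move/eqP: co => sz1 /dvdp_leq; rewrite -size_poly_eq0 sz1; exact.
Qed.

Variables (x : 'I_r -> int) (h : {poly int}) (M : int) (idx : 'I_s -> 'I_r).
Hypothesis size_h : (size h <= n)%N.
Hypothesis red_h : red h = \sum_i (x i)%:~R *: logderiv Q c0 i.
Hypotheses (M_ge1 : 1 <= M) (x_le : forall i, x i ^+ 2 <= M) (h_le : pnorm2 h <= M).
Hypothesis idxK : cancel idx J.
(** Bound for the squared norm of [h] minus a combination of the [Phi j] with coefficients of square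
    at most [M]: twice [M], plus twice [n] coefficients of square [M n^3 N]. *)
Let T := 2 * M * (1 + n%:R ^+ 4 * pnorm2 f).
Hypothesis modulus_large : pnorm2 f ^+ n * T ^+ n < m ^+ 2.

Let T_ge : 4 * M <= T.
Proof.
have n4 : 1 <= n%:R ^+ 4 :> int by rewrite -natrX ler1n expn_gt0 n_gt0.
have z1 : 1 <= n%:R ^+ 4 * pnorm2 f.
  by rewrite -[leLHS]mulr1 ler_pM // pnorm2_ge1.
rewrite -subr_ge0 [leRHS](_ : _ = 2 * M * (n%:R ^+ 4 * pnorm2 f - 1)).
  by rewrite mulr_ge0 ?subr_ge0 // mulr_ge0 // (le_trans _ M_ge1).
by rewrite /T; ring.
Qed.

Let T_lt : T < m ^+ 2.
Proof.
apply: le_lt_trans modulus_large; have N1 := pnorm2_ge1 f_neq0.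
have T1 : 1 <= T by apply: le_trans T_ge; lia.
rewrite -[leLHS]mul1r ler_pM ?exprn_ege1 //; first exact: le_trans T1.
by rewrite -{1}[T]expr1; apply: ler_weXn2l.
Qed.

Lemma red_comb (d : 'I_s -> int) :
  red (h - \sum_j d j *: Phi j) =
  \sum_i (x i - d (J i))%:~R *: logderiv Q c0 i.
Proof.
rewrite rmorphB rmorph_sum /= red_h.
have -> : \sum_j red (d j *: Phi j) = \sum_i (d (J i))%:~R *: logderiv Q c0 i.
  rewrite (eq_bigr (fun j => \sum_(i | J i == j) (d j)%:~R *: logderiv Q c0 i)).
    rewrite (exchange_big_dep xpredT) //=; apply: eq_bigr => i _.
    by rewrite (big_pred1 (J i)) // => j; rewrite eq_sym.
  by move=> j _; rewrite -mul_polyC rmorphM /= map_polyC /= red_Phi mul_polyC scaler_sumr.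
by rewrite -sumrB; apply: eq_bigr => i _; rewrite intrB scalerBl.
Qed.

(** Reducing the divisibility modulo [m] and [Q i] leaves only [x i - d (J i)] times [logderiv i],
    so [m] divides this difference. Its square is at most [4 M <= T < m^2], hence it is 0. *)
Lemma dvd_all_eq (d : 'I_s -> int) i :
  (d (J i)) ^+ 2 <= M ->
  toQ (G (J i)) %| toQ (h - d (J i) *: Phi (J i)) -> x i = d (J i).
Proof.
set j := J i => d_le; rewrite dvdp_rat_int Pdiv.Idomain.dvdp_eq.
set e := scalp _ _; set K0 := _ %/ _ => /eqP dvdE.
pose d' (k : 'I_s) := if k == j then d j else 0.
have sumE : \sum_k d' k *: Phi k = d j *: Phi j.
  rewrite (bigD1 j) //= /d' eqxx big1 ?addr0 // => k /negPf->.
  by rewrite scale0r.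
have := congr1 (fun p => red p) dvdE; rewrite -sumE.
rewrite -mul_polyC !rmorphM /= map_polyC /= mul_polyC red_comb red_G.
rewrite (bigD1 i) //= [in X in _ = _ * (_ *: X)](bigD1 i) //=.
have [K1 ->] := dvd_sum_logderiv Q c0 i (fun k => (x k - d' (J k))%:~R).
rewrite scalerDr scalerA -intrM => /(canRL (addrK _)) redE.
(* The factor [u] comes from pseudo-division over the integers; it is coprime to [m]. *)
set u := lead_coef (G j) ^+ e; set z := x i - d' j in redE.
have uz0 : (u * z)%:~R = 0 :> R.
  apply: (@logderiv_regular _ _ Q c0 Q_monic (red U) (red V) (red E) v%:~R l i
   (red K0 * ((lead_coef (G j))%:~R *: \prod_(k | (J k == j) && (k != i)) Q k) - u%:~R *: K1)) => //.
  - by apply/eqP; rewrite -rmorphXn red_eq0_dvd.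
  - rewrite -red_f deriv_map -!rmorphM -rmorphD bezout_f rmorphD rmorph1 /=.
    by rewrite -[v%:Z *: E]mul_polyC rmorphM /= map_polyC mul_polyC.
  - rewrite redE -!mul_polyC; move: K1 {redE} => K1.
    move: (red K0) (_%:P) (_%:P) (Q i) (\prod_(_ | _) _) => p0 p1 p2 p3 p4.
    by ring.
have m_z : (m %| z)%Z.
  have co : coprimez m u by apply: coprimezXr.
  by rewrite -(Gauss_dvdzr _ co) -red_eq0_dvd uz0.
apply/eqP; rewrite -subr_eq0; have -> : x i - d j = z by rewrite /z /d' eqxx.
apply: contraLR T_lt => z_neq0; rewrite -leNgt.
apply: le_trans (dvdz_sqr_le m_z z_neq0) _.
rewrite /z /d' eqxx; apply: le_trans (sqr_sub_le _ _) _; apply: le_trans _ T_ge.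
by have := x_le i; lia.
Qed.

Lemma recombination : exists d : 'I_s -> int, forall i, x i = d (J i).
Proof.
pose good j := toQ (G j) %| toQ (h - x (idx j) *: Phi j).
have [/forallP all_good|] := boolP [forall j, good j].
  exists (fun j => x (idx j)) => i; apply: (@dvd_all_eq (fun j => x (idx j))) => //.
  exact: all_good.
rewrite negb_forall => /existsP[j0 bad_j0].
(* If [j] is good, then [h3] is a nonzero multiple of [Phi j] modulo [G j]; in
   both cases [c] is chosen small and [G j] does not divide [h3]. *)
pose c j := if good j then (x (idx j) == 0)%:R else x (idx j).
have c_le j : c j ^+ 2 <= M.
  rewrite /c; case: ifP => // _; case: (_ == 0); rewrite ?expr1n //.
  by rewrite expr0n (le_trans _ M_ge1).
pose h3 := h - \sum_j c j *: Phi j.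
(* Since [G j] divides [Phi k] for all [k != j], only [h - c j *: Phi j] matters modulo [G j]. *)
have res0 : resultant f h3 != 0.
  apply: resultant_neq0 => j; have -> : h3 = (h - c j *: Phi j) -
      \sum_(k | k != j) c k *: Phi k.
    by rewrite /h3 (bigD1 j) //= opprD addrA.
  rewrite rmorphB dvdp_subl; last first.
    rewrite rmorph_sum /=; elim/big_rec: _ => [|k p neq_kj dvd_p]; first exact: dvdp0.
    by rewrite dvdp_add // -mul_polyC rmorphM dvdp_mull // dvd_Phi // eq_sym.
  rewrite /c; case: (boolP (good j)) => // good_j.
  set e := _%:R; have xe0 : x (idx j) - e != 0.
    by rewrite /e; case: (x (idx j) =P 0) => [->|/eqP x0]; rewrite ?sub0r ?oppr_eq0 ?oner_eq0 ?subr0.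
  have -> : h - e *: Phi j = (h - x (idx j) *: Phi j) + (x (idx j) - e) *: Phi j.
    by rewrite scalerBl addrA subrK.
  rewrite rmorphD dvdp_addr // -mul_polyC rmorphM /= map_polyC mul_polyC dvdpZr.
    exact: ndvd_Phi.
  by rewrite intr_eq0.
have size_h3 : (size h3 <= n)%N.
  apply: leq_trans (size_polyD _ _) _; rewrite geq_max size_h size_polyN.
  apply: leq_trans (size_sum _ _ _) _; apply/bigmax_leqP => j _.
  exact: leq_trans (size_scale_leq _ _) (size_Phi j).
have h3_le : pnorm2 h3 <= T.
  have M_ge0 : 0 <= M by apply: le_trans M_ge1.
  apply: le_trans (pnorm2_sub_le size_h3 h_le (fun k => coef_sum_Phi_le k M_ge0 c_le)) _.
  by rewrite le_eqVlt /T; apply/orP/or_introl/eqP; ring.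
(* As [j0] is bad, [c j0 = x (idx j0)]: the term of index [idx j0] cancels modulo [m], and
   [Q (idx j0)] divides all the others. *)
have [K1 K1E] := dvd_sum_logderiv Q c0 (idx j0) (fun i => (x i - c (J i))%:~R).
have := @resultant_lower_bound R m f h3 (Q (idx j0))
  (c0 *: \prod_(i | i != idx j0) Q i) K1 n red_eq0_dvd (Q_monic _) (Q_gt1 _).
have red_f1 : red f = Q (idx j0) * (c0 *: \prod_(i | i != idx j0) Q i).
  by rewrite red_f (bigD1 (idx j0)) //= scalerAr.
have red_h3 : red h3 = Q (idx j0) * K1.
  rewrite /h3 red_comb (bigD1 (idx j0)) //= K1E idxK /c (negPf bad_j0).
  by rewrite subrr scale0r add0r.
move/(_ red_f1 red_h3 size_f n_gt0 size_h3 res0).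
rewrite leNgt (le_lt_trans _ modulus_large) //.
rewrite ler_wpM2l ?exprn_ge0 ?pnorm2_ge0 //.
by rewrite lerXn2r ?nnegrE ?pnorm2_ge0 // (le_trans _ h3_le) ?pnorm2_ge0.
Qed.

End Recombination.

(** * The all-coefficients lattice *)

Section Lattice.
Variables (R : comNzRingType) (v l r n : nat) (L : 'I_r -> {poly R}).
Variable a : 'I_n -> 'I_r -> int.
Local Notation m := (v%:Z ^+ l).
Local Notation red := (map_poly (intr : int -> R)).
Hypothesis red_eq0_dvd : forall z : int, (z%:~R == 0 :> R) = (m %| z)%Z.
Hypothesis size_L : forall j, (size (L j) <= n)%N.
Hypothesis a_red : forall i j, (a i j)%:~R = (L j)`_i :> R.

Lemma mul_allcoef_gen (x : 'rV[int]_r) (y : 'rV[int]_n) :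
  row_mx x y *m allcoef_gen v l a =
  row_mx x (x *m (\matrix_(j < r, i < n) a i j) + m *: y).
Proof.
by rewrite mul_row_block mulmx1 mulmx0 addr0 mul_mx_scalar.
Qed.

Let red_row (x : 'rV[int]_r) (i : 'I_n) :
  ((x *m (\matrix_(j < r, i < n) a i j)) 0 i)%:~R =
  (\sum_j (x 0 j)%:~R *: L j)`_i.
Proof.
rewrite mxE rmorph_sum coef_sum; apply: eq_bigr => j _.
by rewrite mxE coefZ /= intrM a_red.
Qed.

Let coef_big (x : 'rV[int]_r) (k : nat) :
  (n <= k)%N -> (\sum_j (x 0 j)%:~R *: L j)`_k = 0.
Proof.
move=> le_nk; rewrite coef_sum big1 // => j _.
by rewrite coefZ nth_default ?mulr0 // (leq_trans (size_L j)).
Qed.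

(** With the converse [mem_lattice], this describes the lattice by a congruence: the last [n]
    coordinates are a polynomial determined modulo [m] by the first [r]. *)
Lemma red_lattice (z c : 'rV[int]_(r + n)) : z = c *m allcoef_gen v l a ->
  red (rVpoly (rsubmx z)) = \sum_j (lsubmx z 0 j)%:~R *: L j.
Proof.
rewrite -[c]hsubmxK mul_allcoef_gen => ->; rewrite row_mxKl row_mxKr.
apply/polyP => k; rewrite coef_map coef_rVpoly; case: insubP => [i _ <-|] /=.
  rewrite mxE intrD red_row -[RHS]addr0; congr (_ + _).
  by apply/eqP; rewrite red_eq0_dvd mxE dvdz_mulr.
by rewrite -leqNgt => le_nk; rewrite coef_big.
Qed.

Lemma mem_lattice (x : 'rV[int]_r) (p : {poly int}) :
  red p = \sum_j (x 0 j)%:~R *: L j ->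
  exists c, row_mx x (poly_rV p) = c *m allcoef_gen v l a.
Proof.
move=> red_p; pose z := poly_rV p - x *m (\matrix_(j < r, i < n) a i j).
exists (row_mx x (map_mx (fun y => y %/ m)%Z z)); rewrite mul_allcoef_gen.
congr row_mx; rewrite -[LHS](subrK (x *m \matrix_(j < r, i < n) a i j)) addrC.
congr (_ + _); apply/rowP => i; rewrite [RHS]mxE [X in _ * X]mxE [RHS]mulrC divzK //.
rewrite -red_eq0_dvd.
rewrite [z 0 i]mxE intrD [X in _ + X%:~R]mxE intrN red_row -red_p coef_map mxE /=.
by rewrite subrr.
Qed.

End Lattice.

Lemma dotr_row_mx (R : comPzRingType) (k1 k2 : nat) (x : 'rV[R]_k1) (y : 'rV[R]_k2) :
  dotr (row_mx x y) (row_mx x y) = dotr x x + dotr y y.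
Proof.
rewrite /dotr big_split_ord /=.
by congr (_ + _); apply: eq_bigr => i _; rewrite (row_mxEl, row_mxEr).
Qed.

Lemma dotr_poly_rV_le (n : nat) (p : {poly int}) :
  dotr (poly_rV p : 'rV_n) (poly_rV p) <= pnorm2 p.
Proof.
apply: le_trans (sum_sqr_coef_le p n); rewrite le_eqVlt; apply/orP; left.
by apply/eqP/eq_bigr => i _; rewrite mxE expr2.
Qed.

Lemma pnorm2_rVpoly (n : nat) (y : 'rV[int]_n) : pnorm2 (rVpoly y) = dotr y y.
Proof.
have szy : (size (rVpoly y) <= n)%N by apply: size_poly.
rewrite /pnorm2 (big_ord_widen _ (fun i => (rVpoly y)`_i ^+ 2) szy) big_mkcond /=.
apply: eq_bigr => i _; rewrite coef_rVpoly_ord -expr2.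
case: ltnP => // /(nth_default 0); rewrite coef_rVpoly_ord => ->.
by rewrite expr0n.
Qed.

(** Consecutive approximations are monic and agree modulo [v], so they have the same degree. *)
Lemma size_vmonic (v : nat) (P : nat -> {poly int}) (k : nat) :
  prime v -> vmonic v P -> size (P k) = size (P 0%N).
Proof.
move=> v_pr [coh mon]; elim: k => // k <-.
have red0 (z : int) : (z%:~R == 0 :> 'F_v) = (v%:Z %| z)%Z by apply: Fp_intr_eq0.
rewrite -(size_red_monic 'F_v (mon k.+1)) -(size_red_monic 'F_v (mon k)).
congr (size _); congr (polyseq _); apply: (red_pcong red0) => i.
by apply: dvdz_trans (coh k i); rewrite exprS dvdz_mulr.
Qed.

Lemma irreducible_scale (K : fieldType) (c : K) (p : {poly K}) :
  c != 0 -> irreducible_poly p -> irreducible_poly (c *: p).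
Proof.
move=> c0 [p_gt1 irr]; split=> [|q q_neq1]; first by rewrite size_scale.
rewrite dvdpZr // => /(irr q q_neq1) /eqp_trans; apply.
by rewrite eqp_sym eqp_scale.
Qed.

(** Gauss's lemma; monicity of [p] forces the scalar to be the leading coefficient of [G]. *)
Lemma monic_rat_factor (f : {poly int}) (p : {poly rat}) :
  p \is monic -> p %| map_poly intr f ->
  exists G H, f = G * H /\ map_poly intr G = (lead_coef G)%:~R *: p.
Proof.
move=> p_mon /dvdpP_rat_int[G [c c0 pE] [H fE]]; exists G, H; split=> //.
have /monicP := p_mon; rewrite pE lead_coefZ lead_coef_map_inj //; last exact: intr_inj.
by rewrite scalerA mulrC => ->; rewrite scale1r.
Qed.

(** * The bound on [v^(l/n)] as an inequality between integers *)

Lemma leq_exp2_pred (n : nat) : (0 < n)%N -> (n <= 2 ^ n.-1)%N.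
Proof. by case: n => // n _; apply: ltn_expl. Qed.

(** Applied with [a = 2^(n-1)], [k = n] and [N] the squared norm of [f]. The part of the difference
    linear in [N] factors through [(a - k) (a + 3 k)]. *)
Lemma norm_budget (R : realDomainType) (a k N : R) :
  1 <= N -> 0 <= k -> k <= a ->
  4 * a ^+ 2 * (1 + k ^+ 4 * N) <= (a + k) ^+ 2 * (5 + a ^+ 2 * k ^+ 2 * N).
Proof.
move=> N1 k0 ka; have a0 := le_trans k0 ka; have N0 : 0 <= N := le_trans ler01 N1.
rewrite -subr_ge0 [leRHS](_ : _ = (a ^+ 2 + 10 * (a * k) + 5 * k ^+ 2) +
  a ^+ 2 * k ^+ 2 * N * ((a - k) * (a + 3 * k))); last by ring.
have ak0 : 0 <= a - k by rewrite subr_ge0.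
by do ?[assumption | exact: sqr_ge0 | exact: ler0n | apply: addr_ge0 | apply: mulr_ge0].
Qed.

Lemma modulus_bound (n r l v : nat) (N : int) :
  let X : int := r%:R ^+ 2 + (2 ^+ n.-1) ^+ 2 * n%:R ^+ 2 * N in
  let q : algC := sqrtC X%:~R in
  (2 <= n)%N -> 1 <= N ->
  sqrtC N%:~R * (2 ^+ n.-1 + n%:R) * q * (1 + q) < n.-root ((v%:R : algC) ^+ l) ->
  N ^+ n * (2 * (2 * (2 ^+ n.-1) ^+ 2 * X) * (1 + n%:R ^+ 4 * N)) ^+ n
    < (v%:Z ^+ l) ^+ 2.
Proof.
move=> X q n_ge2 N1; have n_gt0 : (0 < n)%N := ltnW n_ge2.
have N0 : 0 <= N by apply: le_trans N1.
set a : int := 2 ^+ n.-1; have a_ge : n%:R <= a.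
  by rewrite /a -natrX ler_nat leq_exp2_pred.
have n2 : 2 <= n%:R :> int by rewrite ler_nat.
have X_ge : a ^+ 2 * n%:R ^+ 2 * N <= X by rewrite lerDr sqr_ge0.
have X4 : 4 <= X.
  apply: le_trans X_ge; rewrite -[leLHS]mulr1 ler_pM // -[leLHS]mul1r ler_pM //.
    by rewrite exprn_ege1 // (le_trans _ a_ge) // (le_trans _ n2).
  by rewrite (_ : 4 = 2 ^+ 2) // lerXn2r ?nnegrE.
have X0 : 0 <= X by apply: le_trans X4.
have q0 : 0 <= q by rewrite sqrtC_ge0 ler0z.
have q2 : 2 <= q by rewrite -(ler_pXn2r (n := 2)) ?nnegrE // sqrtCK -natrX (ler_int _ 4).
set Y := _ * _ => Y_lt.
have Y0 : 0 <= Y.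
  have sN0 : 0 <= sqrtC (N%:~R : algC) by rewrite sqrtC_ge0 ler0z.
  by do ?[assumption | exact: ler0n | exact: exprn_ge0 | apply: addr_ge0 | apply: mulr_ge0].
have Yn : Y ^+ n < v%:R ^+ l.
  rewrite -[ltRHS](rootCK n_gt0) ltr_pXn2r ?nnegrE //.
  by rewrite rootC_ge0 // exprn_ge0 ?ler0n.
rewrite -exprMn -(ltr_int algC) !rmorphXn /= -pmulrn.
apply: le_lt_trans (_ : (Y ^+ n) ^+ 2 < _); last first.
  by rewrite ltr_pXn2r ?nnegrE ?exprn_ge0 ?ler0n.
rewrite -exprM mulnC exprM; apply: lerXn2r; rewrite ?nnegrE ?exprn_ge0 //.
  by rewrite ler0z !(mulr_ge0, addr_ge0, exprn_ge0).
have -> : Y ^+ 2 = N%:~R * (a + n%:R)%:~R ^+ 2 * X%:~R * (1 + q) ^+ 2.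
  have -> : (a + n%:R)%:~R = 2 ^+ n.-1 + n%:R :> algC.
    by rewrite intrD rmorphXn /= !mulrz_nat.
  by rewrite /Y !exprMn !sqrtCK.
(* An integer stepping stone: [(1 + q)^2 = 1 + 2 q + X], where [q >= 2] gives [1 + 2 q >= 5], and
   [X >= a^2 n^2 N]. *)
apply: le_trans (_ : (N * (a + n%:R) ^+ 2 * X *
    (5 + a ^+ 2 * n%:R ^+ 2 * N))%:~R <= _).
  rewrite ler_int; have := norm_budget N1 (ler0n _ n) a_ge.
  set u := leLHS; set w := leRHS => u_w.
  have -> : N * (2 * (2 * a ^+ 2 * X) * (1 + n%:R ^+ 4 * N)) = N * X * u.
    by rewrite /u; ring.
  have -> : N * (a + n%:R) ^+ 2 * X * (5 + a ^+ 2 * n%:R ^+ 2 * N) = N * X * w.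
    by rewrite /w; ring.
  by rewrite ler_wpM2l ?mulr_ge0.
rewrite intrM [in leLHS]intrM [in leLHS]intrM rmorphXn /=.
apply: ler_wpM2l.
  have a_ge0 : 0 <= a by apply: le_trans a_ge.
  by do ?[apply: mulr_ge0 | apply: exprn_ge0 | rewrite ler0z ?addr_ge0 //].
rewrite sqrrD expr1n mul1r sqrtCK intrD.
have -> : 5%:~R = 1 + 2 *+ 2 :> algC by rewrite mulrz_nat -mulrnA -mulrS.
rewrite -[leLHS]addrA -[leRHS]addrA lerD2l; apply: lerD; first exact: (ler_wMn2r 2 q2).
by rewrite ler_int.
Qed.

(** * The projection of [L'] compared with [W] *)

Theorem theorem4p3
  (v : nat) (f : {poly int}) (n r s : nat)
  (F : 'I_r -> nat -> {poly int})          (* the v-adic factors f_1..f_r *)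
  (g : 'I_s -> {poly rat})                 (* the rational factors g_1..g_s *)
  (w : 'I_s -> 'I_r -> bool)               (* w_{j,i} *)
  (l : nat) (a : 'I_n -> 'I_r -> int)
  (b : 'M[int]_(r + n))                    (* rows b_1..b_{r+n} *)
  (t : nat) :
  prime v ->
  size f = n.+1 -> (2 <= n)%N ->
  separable_poly (map_poly (fun z : int => z%:~R : rat) f) ->
  ~~ ((v%:Z) %| lead_coef f)%Z ->
  separable_poly (map_poly (fun z : int => z%:~R : 'F_v) f) ->
  (* f = l_f f_1 ... f_r with f_i in Z_v[X] monic irreducible over Q_v *)
  (forall i, vmonic v (F i)) ->
  (forall i, vQirreducible v (F i)) ->
  (forall k, pcong ((v%:Z) ^+ k.+1) f (lead_coef f *: \prod_(i < r) F i k)) ->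
  (* f = l_f g_1 ... g_s with g_j in Q[X] monic irreducible *)
  (forall j, g j \is monic) ->
  (forall j, irreducible_poly (g j)) ->
  map_poly (fun z : int => z%:~R : rat) f = (lead_coef f)%:~R *: \prod_(j < s) g j ->
  (* g_j = prod_i f_i^{w_{j,i}} in Z_v[X] *)
  (forall j k c, ((v%:Z) ^+ k.+1 %|
       numq ((g j)`_c - ((\prod_(i < r | w j i) F i k)`_c)%:~R))%Z) ->
  (* a_{i,j} = coefficient of X^i in Phi(f_j) modulo v^l *)
  (0 < l)%N ->
  (forall i j, ((v%:Z) ^+ l %| a i j - (Phi_approx f (F j) l.-1)`_i)%Z) ->
  (* b is a basis of L, LLL-reduced with parameter 3/4 *)
  (forall x : 'rV[int]_(r + n),
     (exists c : 'rV[int]_(r + n), x = c *m b) <->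
     (exists c : 'rV[int]_(r + n), x = c *m allcoef_gen v l a)) ->
  (forall c : 'rV[int]_(r + n), c *m b = 0 -> c = 0) ->
  lll_reduced b ->
  (* t = smallest index with ||b_j^*|| > B' for all j > t (1-based),
     i.e. for all 0-based indices j >= t *)
  let normf := polynorm f in
  let B := 2 ^+ n.-1 * n%:R * normf in
  let B' := sqrtC (r%:R ^+ 2 + B ^+ 2) in
  let big (j : nat) := B' < sqrtC (ratr (gsnorm2 (rowq b) j)) in
  (forall j : 'I_(r + n), (t <= j)%N -> big j) ->
  (forall t' : nat, (forall j : 'I_(r + n), (t' <= j)%N -> big j) -> (t <= t')%N) ->
  (* v^{l/n} > ||f|| (2^{n-1} + n) B' (1 + B') *)
  normf * (2 ^+ n.-1 + n%:R) * B' * (1 + B') < n.-root ((v%:R : algC) ^+ l) ->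
  (* projection of L' = Z b_1 + ... + Z b_t onto the first r coordinates is W *)
  forall y : 'rV[int]_r,
    (exists c : 'rV[int]_(r + n),
        (forall i : 'I_(r + n), (t <= i)%N -> c 0 i = 0) /\ y = lsubmx (c *m b)) <->
    (exists d : 'rV[int]_s, y = d *m \matrix_(j < s, i < r) (w j i : nat)%:R).
Proof.
move=> v_pr size_f n_ge2 sep_f v_lead sep_fv F_mon F_irr F_prod g_mon g_irr g_prod w_def.
move=> l_gt0 a_def b_span _ b_red normf B B' big big_t t_min modulus y.
(* With [l = k + 1], the approximation of index [k] is the one valid modulo [v^l]. *)
case: l l_gt0 a_def b_span modulus => // k _ a_def b_span modulus.
have n_gt0 : (0 < n)%N := ltnW n_ge2.
have f_neq0 : f != 0 by rewrite -size_poly_eq0 size_f.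
have v_gt1 := prime_gt1 v_pr.
have redF0 (z : int) : (z%:~R == 0 :> 'F_v) = (v%:Z %| z)%Z by apply: Fp_intr_eq0.
pose R := 'Z_(v ^ k.+1).
have redZ0 (z : int) : (z%:~R == 0 :> R) = (v%:Z ^+ k.+1 %| z)%Z.
  rewrite Zp_intr_eq0; last by rewrite -[1%N](exp1n k.+1) ltn_exp2r.
  by rewrite -natz natrX natz.
have size_F i j : size (F i j) = size (F i 0%N) := size_vmonic j v_pr (F_mon i).
have F_gt1 i j : (1 < size (F i j))%N by rewrite size_F; have [] := F_irr i.
pose Q i : {poly R} := map_poly intr (F i k).
have Q_mon i : Q i \is monic by apply/monic_red/(F_mon i).2.
have Q_gt1 i : (1 < size (Q i))%N by rewrite size_red_monic ?F_gt1 //; apply: (F_mon i).2.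
pose c0 : R := (lead_coef f)%:~R.
have red_f : map_poly intr f = c0 *: \prod_i Q i.
  by rewrite (red_pcong redZ0 (F_prod k)) -mul_polyC rmorphM /= map_polyC mul_polyC rmorph_prod.
have lead_f : coprimez (v%:Z ^+ k.+1) (lead_coef f).
  by rewrite coprimezXl // coprimezE /= prime_coprime.
have [U [V [E bez]]] := bezout_mod_prime v_pr sep_fv.
have facto j : exists GH : {poly int} * {poly int},
    f = GH.1 * GH.2 /\ map_poly intr GH.1 = (lead_coef GH.1)%:~R *: g j.
  have [|G [H [fE GE]]] := monic_rat_factor (f := f) (g_mon j); last by exists (G, H).
  by rewrite g_prod (bigD1 j) //= -mul_polyC dvdp_mull // dvdp_mulr.
have [GH GHP] := fin_all_exists facto.
pose G j := (GH j).1; pose H j := (GH j).2.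
have fGH j : f = G j * H j := (GHP j).1.
have GE j : map_poly intr (G j) = (lead_coef (G j))%:~R *: g j := (GHP j).2.
have lead_G_neq0 j : lead_coef (G j) != 0.
  rewrite lead_coef_eq0; apply: contraNneq f_neq0 => G0.
  by rewrite (fGH j) G0 mul0r.
have G_irr j : irreducible_poly (map_poly (intr : int -> rat) (G j)).
  by rewrite GE; apply: irreducible_scale; rewrite ?intr_eq0.
pose cG := \prod_j lead_coef (G j).
have cG_neq0 : cG != 0 by apply/prodf_neq0 => j _.
have G_prod : \prod_j map_poly (intr : int -> rat) (G j) = cG%:~R *: \prod_j g j.
  rewrite -mul_polyC rmorph_prod /= rmorph_prod /= -big_split /=.
  by apply: eq_bigr => j _; rewrite GE mul_polyC.
have f_prod : map_poly (intr : int -> rat) f =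
    ((lead_coef f)%:~R / cG%:~R) *: \prod_j map_poly intr (G j).
  by rewrite G_prod scalerA divfK ?intr_eq0.
(* The factorization with denominators cleared, so that it can be reduced modulo [v]. *)
have f_prodZ : cG *: f = lead_coef f *: \prod_j G j.
  apply: (map_inj_poly (f := (intr : int -> rat))) => //; first exact: intr_inj.
  rewrite !map_polyZ /= [map_poly _ (\prod_j _)]rmorph_prod /= G_prod.
  by rewrite scalerA mulrC -scalerA -g_prod.
(* The supports [w j] are shown to partition the indices by working over the field [F_v], where [f]
   remains separable; the resulting map [J] then serves modulo [v^l]. *)
pose q i : {poly 'F_v} := map_poly intr (F i 0%N).
have q_mon i : q i \is monic by apply/monic_red/(F_mon i).2.
have lead_Fv : (lead_coef f)%:~R != 0 :> 'F_v by rewrite redF0.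
have red_fq : map_poly intr f = (lead_coef f)%:~R *: \prod_i q i.
  rewrite (red_pcong (m := v%:Z) redF0 (F_prod 0%N)) -mul_polyC rmorphM /=.
  by rewrite map_polyC mul_polyC rmorph_prod.
have red_Gq j : map_poly intr (G j) = (lead_coef (G j))%:~R *: \prod_(i | w j i) q i.
  rewrite (red_of_numq (m := v%:Z) redF0 (fun i => w_def j 0%N i) (GE j)).
  by rewrite rmorph_prod.
have q_prod : \prod_j \prod_(i | w j i) q i = \prod_i q i.
  have cG_Fv : cG%:~R != 0 :> 'F_v.
    rewrite rmorph_prod; apply/prodf_neq0 => j _.
    apply: contraNneq lead_Fv; rewrite (fGH j) lead_coefM intrM => ->.
    by rewrite mul0r.
  have := congr1 (map_poly (intr : int -> 'F_v)) f_prodZ.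
  rewrite !map_polyZ /= [map_poly _ (\prod_j _)]rmorph_prod /= red_fq.
  rewrite (eq_bigr _ (fun j _ => red_Gq j)).
  have -> : \prod_j ((lead_coef (G j))%:~R *: \prod_(i | w j i) q i) =
      cG%:~R *: \prod_j \prod_(i | w j i) q i.
    rewrite -mul_polyC rmorph_prod /= rmorph_prod /= -big_split /=.
    by apply: eq_bigr => j _; rewrite mul_polyC.
  rewrite !scalerA mulrC => /esym; apply: scalerI.
  by rewrite mulf_neq0.
have q_gt1 i : (1 < size (q i))%N by rewrite size_red_monic ?F_gt1 //; apply: (F_mon i).2.
have [|J JP] := fin_all_exists (squarefree_prod_partition _ lead_Fv q_gt1 q_prod).
  by rewrite -red_fq.
have wJ j i : w j i = (J i == j).
  apply/idP/eqP => [wji|<-]; last exact: (JP i).1.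
  by apply/esym/(JP i).2.
have r_le_n : (r <= n)%N.
  have : (size (map_poly (intr : int -> 'F_v) f) <= n.+1)%N.
    by rewrite -size_f; apply: size_poly.
  rewrite red_fq size_scale // size_prod => [|i _]; last exact: monic_neq0.
  have : (\sum_(i < r) 2 <= \sum_i size (q i))%N by apply: leq_sum => i _.
  by rewrite sum_nat_const card_ord; move: (\sum_i _)%N => z; lia.
have red_G j : map_poly intr (G j) =
    (lead_coef (G j))%:~R *: \prod_(i | J i == j) Q i.
  rewrite (red_of_numq redZ0 (fun i => w_def j k i) (GE j)) rmorph_prod /=.
  by congr (_ *: _); apply: eq_bigl => i; rewrite wJ.
have [idx idxK] := fin_all_exists (J_surj redZ0 lead_f fGH G_irr red_G).
pose L := logderiv Q c0.
have size_L j : (size (L j) <= n)%N.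
  apply: size_logderiv => //; rewrite -red_f -size_f; exact: size_poly.
have a_red i j : (a i j)%:~R = (L j)`_i :> R.
  rewrite (intr_modz redZ0 (a_def i j)) /Phi_approx /= -coef_map /=.
  rewrite (red_divp (L := L j)) //; first exact: (F_mon j).2.
  by rewrite rmorphM /= -deriv_map red_f mul_logderiv.
pose N := pnorm2 f; have N1 : 1 <= N := pnorm2_ge1 f_neq0.
pose X : int := r%:R ^+ 2 + (2 ^+ n.-1) ^+ 2 * n%:R ^+ 2 * N.
have N0 : 0 <= N by apply: le_trans N1.
have normfE : normf = sqrtC N%:~R.
  by congr sqrtC; rewrite rmorph_sum; apply: eq_bigr => i _; rewrite rmorphXn.
have XE : r%:R ^+ 2 + B ^+ 2 = X%:~R.
  rewrite /B normfE !exprMn sqrtCK intrD !intrM !rmorphXn /=.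
  by rewrite !mulrz_nat.
have B'E : B' = sqrtC X%:~R by rewrite /B' XE.
have X0 : 0 <= X by rewrite addr_ge0 ?sqr_ge0 // mulr_ge0 // mulr_ge0 ?sqr_ge0.
have bigE j : big j = (X%:~R < gsnorm2 (rowq b) j).
  have g_ge0 : 0 <= gsnorm2 (rowq b) j by apply: dotr_ge0.
  rewrite /big B'E ltr_sqrtC ?qualifE /= ?ler0z ?ler0q //.
  by rewrite -[X%:~R]ratr_int ltr_rat.
have := modulus; rewrite normfE B'E => /(modulus_bound n_ge2 N1) modulusZ.
have dotr_split (z : 'rV[int]_(r + n)) :
    dotr z z = dotr (lsubmx z) (lsubmx z) + pnorm2 (rVpoly (rsubmx z)).
  by rewrite pnorm2_rVpoly -{1 2}[z]hsubmxK dotr_row_mx.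
split=> [[c [c_t ->]]|[d ->]].
  (* [X] is the square of [B'], and [t <= r + n <= 2 n] gives [2^(t-1) <= 2^(2n-1)], the factor in
     front of [X]. *)
  pose M : int := 2 * (2 ^+ n.-1) ^+ 2 * X.
  have row_const (i : 'I_(r + n)) : (i < t)%N ->
      exists d : 'I_s -> int, forall h, lsubmx (row i b) 0 h = d (J h).
    move=> lt_it; have [e rowE] : exists e, row i b = e *m allcoef_gen v k.+1 a.
      by apply/b_span; exists (delta_mx 0 i); rewrite -rowE.
    have row_le : dotr (row i b) (row i b) <= M.
      have t_gt0 : (0 < t)%N := leq_ltn_trans (leq0n i) lt_it.
      have t_le : (t <= r + n)%N.
        by apply: t_min => j; rewrite leqNgt ltn_ord.
      have lt_t : (t.-1 < r + n)%N by rewrite prednK.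
      (* Minimality of [t]: otherwise [t.-1] would satisfy the defining condition as well. *)
      have small : gsnorm2 (rowq b) t.-1 <= X%:~R.
        rewrite leNgt -bigE; apply/negP => big_pred_t.
        have := t_min t.-1; rewrite leqNgt prednK // leqnn => absurd.
        suff : false by []; apply: absurd => j.
        rewrite leq_eqVlt => /orP[/eqP<- //|]; rewrite prednK //.
        exact: big_t.
      rewrite -(ler_int rat).
      have le_it : (i <= Ordinal lt_t)%N by rewrite /= -ltnS prednK.
      apply: le_trans (lll_norm2_le b_red le_it) _ => /=.
      rewrite /M intrM -exprM -exprS rmorphXn /= mulrz_nat.
      apply: le_trans (_ : 2 ^+ t.-1 * X%:~R <= _); first by rewrite ler_wpM2l ?exprn_ge0.
      rewrite ler_wpM2r ?ler0z //; apply: ler_weXn2l => //.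
      by lia.
    have row_ge0 : 0 <= dotr (lsubmx (row i b)) (lsubmx (row i b)) by apply: dotr_ge0.
    apply: (@recombination R v k.+1 f n r s Q c0 U V E G H _ J redZ0 size_f n_gt0
      Q_mon Q_gt1 red_f lead_f bez sep_f fGH G_irr f_prod red_G _
      (rVpoly (rsubmx (row i b))) M idx) => //.
    - exact: size_poly.
    - exact: red_lattice rowE.
    - have X_gt0 : 0 < X.
        apply: ltr_wpDl; first exact: sqr_ge0.
        by do ?[apply: mulr_gt0 | apply: exprn_gt0 | rewrite ltr0n // | exact: lt_le_trans N1].
      by rewrite -gtz0_ge1 !mulr_gt0 ?exprn_gt0.
    - move=> h; apply: le_trans row_le; rewrite dotr_split.
      apply: le_trans (_ : dotr (lsubmx (row i b)) (lsubmx (row i b)) <= _).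
        rewrite /dotr (bigD1 h) //= -expr2 lerDl sumr_ge0 // => u _.
        by rewrite -expr2 sqr_ge0.
      by rewrite lerDl pnorm2_ge0.
    - by apply: le_trans row_le; rewrite dotr_split lerDr.
  (* The condition [i < t] goes under the existential, with default 0, so that one choice covers all
     rows. *)
  have row_const' (i : 'I_(r + n)) : exists d : 'I_s -> int,
      (i < t)%N -> forall h, lsubmx (row i b) 0 h = d (J h).
    have [/row_const[d dP]|_] := ltnP i t; first by exists d.
    by exists (fun=> 0).
  have [d dP] := fin_all_exists row_const'.
  exists (\row_j \sum_i c 0 i * d i j); apply/rowP => h.
  rewrite !mxE (bigD1 (J h)) //= !mxE wJ eqxx mulr1 [X in _ + X]big1 ?addr0 => [|j neq_j].
    apply: eq_bigr => i _; have [lt_it|le_ti] := ltnP i t; last by rewrite c_t ?mul0r.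
    by congr (_ * _); rewrite -dP // !mxE.
  by rewrite !mxE wJ eq_sym (negPf neq_j) mulr0.
(* The vector formed by [w_j] and [Phi (g_j)] lies in the lattice and is no longer than [B'], so its
   coordinates from [t] on vanish. *)
have vecP j : exists c : 'rV[int]_(r + n),
    (forall i : 'I_(r + n), (t <= i)%N -> c 0 i = 0) /\
    lsubmx (c *m b) = \row_i (w j i : nat)%:R.
  pose x : 'rV[int]_r := \row_i (w j i : nat)%:R.
  have [|c0' /(ex_intro _ c0')/b_span[c cE]] :=
      mem_lattice redZ0 a_red (x := x) (p := H j * (G j)^`()).
    rewrite (red_Phi Q_mon red_f fGH red_G) big_mkcond; apply: eq_bigr => i _.
    by rewrite mxE wJ mulrz_nat; case: eqP; rewrite ?scale1r ?scale0r.
  exists c; split; last by rewrite -cE row_mxKl.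
  apply: short_vector_support => i le_ti; have := big_t i le_ti.
  rewrite bigE; apply: le_lt_trans.
  (* The two summands of [X] bound the two blocks: [|w_j|^2 <= r <= r^2], and
     [n^4 N <= (2^(n-1))^2 n^2 N]. *)
  rewrite ler_int -cE dotr_row_mx; apply: lerD.
    apply: le_trans (_ : \sum_(i < r) 1 <= _).
      by apply: ler_sum => h _; rewrite mxE; case: (w j h).
    by rewrite sumr_const card_ord -natrX ler_nat -mulnn; case: (r) => // r'; apply: leq_pmulr.
  apply: le_trans (dotr_poly_rV_le _ _) _.
  apply: le_trans (pnorm2_Phi_le size_f fGH f_prod j) _.
  rewrite ler_wpM2r // (exprD _ 2 2) ler_wpM2r ?sqr_ge0 // lerXn2r ?nnegrE ?exprn_ge0 //.
  by rewrite -natrX ler_nat leq_exp2_pred.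
have [cv cvP] := fin_all_exists vecP.
exists (\sum_j d 0 j *: cv j); split=> [i le_ti|].
  rewrite summxE big1 // => j _; rewrite mxE (cvP j).1 ?mulr0 //.
rewrite mulmx_suml raddf_sum /= mulmx_sum_row; apply: eq_bigr => j _.
rewrite -scalemxAl linearZ /= (cvP j).2; congr (_ *: _).
by apply/rowP => i; rewrite !mxE.
Qed.
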